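(* Let $n\ge 1$ and let $A$ be an expansive real $n\times n$ matrix. Suppose that the transpose $A^{*}$ has a real eigenvalue $\lambda\in\mathbb{R}$ with an associated eigenvector $v\in\mathbb{R}^n\setminus\{0\}$. Let $0<r<R$ with $|\lambda|>R/r$, and let $\mathfrak{R}(A;r,R)$ be the class of radial functions $\psi$ on $\mathbb{R}^n$ that satisfy the standing hypothesis with respect to $A$ (see context) and have $\mathrm{supp}\,\widehat{\psi}\subset\mathcal{A}(r,R)=\{\xi\in\mathbb{R}^n : r\le|\xi|\le R\}$. Then $$\varepsilon_2(A;r,R):=\inf_{\psi\in\mathfrak{R}(A;r,R)}\bigl\|U_{\psi,\psi}-\mathrm{Id}\bigr\|_{L^2\to L^2}=1.$$
   Context: Fourier transform: $\hat f(\xi)=\int_{\mathbb{R}^n} f(x)e^{-2\pi i x\cdot\xi}\,dx$. $\mathcal{S}(\mathbb{R}^n)$ denotes the Schwartz functions; $|\cdot|$ is the Euclidean norm on $\mathbb{R}^n$; $L^2=L^2(\mathbb{R}^n)$. A real $n\times n$ matrix $A$ is expansive if every eigenvalue $\mu$ of $A$ satisfies $|\mu|>1$. Put $b:=|\det A|>1$, and let $|\lambda_-|$ be the smallest modulus of an eigenvalue of $A$. $A^*$ is the transpose of $A$. Step homogeneous quasi-norm (Bownik): there is an open ellipsoid $\Delta$ centred at $0$ with $|\Delta|=1$ and $\Delta\subset t\Delta\subset A\Delta$ for some $t>1$; fix one, put $B_k:=A^k\Delta$ ($k\in\mathbb{Z}$), and set $\rho_A(x)=b^k$ for $x\in B_{k+1}\setminus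 B_k$, $\rho_A(0)=0$. An anisotropic annulus is a set $\{\xi : r_A\le\rho_A(\xi)\le R_A\}$ with $0<r_A<R_A<\infty$. Standing hypothesis on $\psi$: $\psi\in\mathcal{S}(\mathbb{R}^n)$ (this is the meaning given to ''anisotropic decay adapted to $\rho_A$''); $\psi$ has vanishing moments $\int x^\alpha\psi(x)\,dx=0$ for $|\alpha|\le\mathcal{N}_p(A):=\lfloor(\tfrac1p-1)\tfrac{\ln b}{\ln|\lambda_-|}\rfloor$, for every $p\in(0,1]$; and $\hat\psi$ is supported in an anisotropic annulus contained in $[-1/2,1/2]^n\setminus\{0\}$. Affine system and frame operator: $\psi_{j,k}(x):=b^{j/2}\psi(A^jx-k)$ for $j\in\mathbb{Z}$, $k\in\mathbb{Z}^n$, and $U_{\psi,\psi}f:=\sum_{j\in\mathbb{Z}}\sum_{k\in\mathbb{Z}^n}\langle f,\psi_{j,k}\rangle\psi_{j,k}$. *)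

(* Defs.v *)
From HB Require Import structures.
From mathcomp Require Import all_boot all_order all_algebra finmap complex.
From mathcomp Require Import all_classical all_reals all_analysis.
From mathcomp Require analysis.showcase.summability.

Set Implicit Arguments.
Unset Strict Implicit.
Unset Printing Implicit Defensive.

Import Order.TTheory GRing.Theory Num.Theory.
Import numFieldNormedType.Exports.

Local Open Scope classical_set_scope.
Local Open Scope ring_scope.
Local Open Scope complex_scope.

(* Borel sigma-algebra of R^n, as the product sigma-algebra on column vectors *)
Section measurable_vector.
Context (R : realType) (n : nat).

Definition vcoord (i : 'I_n) (x : 'cV[R]_n) : R := x i 0.

Let vec_set0 : g_sigma_preimage vcoord set0.
Proof. exact: sigma_algebra0. Qed.

Let vec_setC A : g_sigma_preimage vcoord A -> g_sigma_preimage vcoord (~` A).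
Proof. exact: sigma_algebraC. Qed.

Let vec_bigcup (F : (set 'cV[R]_n)^nat) :
  (forall i, g_sigma_preimage vcoord (F i)) ->
  g_sigma_preimage vcoord (\bigcup_i F i).
Proof. exact: sigma_algebra_bigcup. Qed.

HB.instance Definition _ := @isMeasurable.Build default_measure_display
  'cV[R]_n (g_sigma_preimage vcoord) vec_set0 vec_setC vec_bigcup.

Lemma measurable_vcoord (i : 'I_n) : measurable_fun setT (vcoord i).
Proof.
move=> _ B mB; apply: sub_sigma_algebra.
by rewrite (bigD1 i)//=; left; exists B.
Qed.

Lemma measurable_fun_vecP d (T : measurableType d) (f : T -> 'cV[R]_n) :
  (forall i, measurable_fun setT (vcoord i \o f)) -> measurable_fun setT f.
Proof.
move=> mf; have : preimage_set_system setT f measurable `<=` measurable.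
  rewrite -[X in preimage_set_system _ _ X]/(g_sigma_preimage vcoord).
  rewrite -g_sigma_preimageE; apply: smallest_sub.
    exact: sigma_algebra_measurable.
  move=> _ [A + <-].
  have -> : \big[setU/set0]_(i < n) preimage_set_system setT (vcoord i) measurable
     = [set A | exists2 i, xpredT i & preimage_set_system setT (vcoord i) measurable A].
    by rewrite -bigcup_seq; apply/seteqP; split => [B [i _ ?]|B [i _ ?]];
       exists i => //=; rewrite mem_index_enum.
  move=> [i _ [B mB <-]]; rewrite !setTI -comp_preimage -[X in measurable X]setTI.
  exact: mf.
by move=> h _ B mB; apply: h; exists B.
Qed.

End measurable_vector.

Section lebesgue_vector.
Context (R : realType).

Definition vcons n (p : measurableTypeR R * 'cV[R]_n) : 'cV[R]_n.+1 :=
  \col_i (if unlift ord0 i is Some j then p.2 j 0 else p.1).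

Lemma vcons0 n (p : measurableTypeR R * 'cV[R]_n) : vcons p ord0 0 = p.1.
Proof. by rewrite mxE unlift_none. Qed.

Lemma vconsS n (p : measurableTypeR R * 'cV[R]_n) (i : 'I_n) :
  vcons p (lift ord0 i) 0 = p.2 i 0.
Proof. by rewrite mxE liftK. Qed.

Definition vtail n (x : 'cV[R]_n.+1) : 'cV[R]_n := \col_i x (lift ord0 i) 0.

Lemma vtail_cons n (p : measurableTypeR R * 'cV[R]_n) : vtail (vcons p) = p.2.
Proof. by apply/colP => i; rewrite mxE vconsS. Qed.

Lemma measurable_vcons n : measurable_fun setT (@vcons n).
Proof.
apply: measurable_fun_vecP => i; case: (unliftP ord0 i) => [k|] ->.
  rewrite (_ : _ \o _ = @vcoord R n k \o snd); last first.
    by apply/funext => p; rewrite /= /vcoord vconsS.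
  apply: measurableT_comp; [exact: measurable_vcoord|exact: measurable_snd].
rewrite (_ : _ \o _ = fst); first exact: measurable_fst.
by apply/funext => p; rewrite /= /vcoord vcons0.
Qed.

Lemma measurable_vtail n : measurable_fun setT (@vtail n).
Proof.
apply: measurable_fun_vecP => i.
rewrite (_ : _ \o _ = vcoord (lift ord0 i)); first exact: measurable_vcoord.
by apply/funext => x; rewrite /= /vcoord mxE.
Qed.

Section step.
Context (n : nat) (mu : {sigma_finite_measure set 'cV[R]_n -> \bar R}).

Definition lebesgue_step : set 'cV[R]_n.+1 -> \bar R :=
  pushforward (@lebesgue_measure R \x mu)%E (@vcons n).

Let step0 : lebesgue_step set0 = 0%E.
Proof. by rewrite /lebesgue_step /pushforward preimage_set0 measure0. Qed.

Let step_ge0 A : (0 <= lebesgue_step A)%E.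
Proof. by rewrite /lebesgue_step /pushforward measure_ge0. Qed.

Let step_sigma_additive : semi_sigma_additive lebesgue_step.
Proof.
apply: measure_semi_sigma_additive => //; exact: measurable_vcons.
Qed.

HB.instance Definition _ := isMeasure.Build _ _ _ lebesgue_step
  step0 step_ge0 step_sigma_additive.

Let step_sigma_finite : sigma_finite setT lebesgue_step.
Proof.
have /sigma_finiteP[F [TF ndF Foo]] := sigma_finiteT (@lebesgue_measure R).
have /sigma_finiteP[G [TG ndG Goo]] := sigma_finiteT mu.
exists (fun k => vcoord ord0 @^-1` F k `&` @vtail n @^-1` G k).
  apply/esym/seteqP; split => // x _.
  have : setT (x ord0 0 : measurableTypeR R) by [].
  rewrite TF => -[i _ Fi]; have : setT (vtail x) by [].
  rewrite TG => -[j _ Gj]; exists (maxn i j) => //; split.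
    by have /subsetPset := ndF _ _ (leq_maxl i j); exact.
  by have /subsetPset := ndG _ _ (leq_maxr i j); exact.
move=> k; have [mF Fk] := Foo k; have [mG Gk] := Goo k; split.
  apply: measurableI; rewrite -[X in measurable X]setTI.
    exact: (@measurable_vcoord R n.+1).
  exact: measurable_vtail.
rewrite /lebesgue_step /pushforward (_ : _ @^-1` _ = F k `*` G k).
  by rewrite product_measure1E// lte_mul_pinfty// ge0_fin_numE.
by apply/seteqP; split => p /=; rewrite /vcoord vcons0 vtail_cons.
Qed.

HB.instance Definition _ := Measure_isSigmaFinite.Build _ _ _ lebesgue_step
  step_sigma_finite.

End step.

(* n-dimensional Lebesgue measure: the n-fold product of [lebesgue_measure] *)
Fixpoint lebesgue_vec n : {sigma_finite_measure set 'cV[R]_n -> \bar R} :=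
  match n with
  | 0 => \d_(0 : 'cV[R]_0)
  | n.+1 => lebesgue_step (lebesgue_vec n)
  end.

Lemma lebesgue_vec_box n (a b : 'I_n -> R) : (forall i, a i <= b i) ->
  lebesgue_vec n [set x : 'cV[R]_n | forall i, a i <= x i 0 <= b i] =
  (\prod_(i < n) (b i - a i))%:E.
Proof.
have mbox m (c e : 'I_m -> R) :
    measurable [set x : 'cV[R]_m | forall i, c i <= x i 0 <= e i].
  have -> : [set x : 'cV[R]_m | forall i, c i <= x i 0 <= e i] =
      \big[setI/setT]_i (vcoord i @^-1` `[c i, e i]).
    rewrite -bigcap_seq; apply/seteqP; split => x /= h i.
      by move=> _; rewrite /= in_itv/= /vcoord h.
    by have := h i (mem_index_enum _); rewrite /= in_itv.
  apply: bigsetI_measurable => i _; rewrite -[X in measurable X]setTI.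
  exact: (@measurable_vcoord R m i).
elim: n a b => [|n IH] a b ab.
  by rewrite big_ord0 /= diracE mem_set// => -[].
rewrite big_ord_recl EFinM -IH//.
have E : @vcons n @^-1` [set x : 'cV[R]_n.+1 | forall i, a i <= x i 0 <= b i] =
    `[a ord0, b ord0]%classic `*`
    [set x : 'cV[R]_n | forall i : 'I_n, a (lift ord0 i) <= x i 0 <= b (lift ord0 i)].
  apply/seteqP; split => [p h|p [h0 h]] /=.
    split; first by have := h ord0; rewrite vcons0 /= in_itv.
    by move=> i; have := h (lift ord0 i); rewrite vconsS.
  move=> i; case: (unliftP ord0 i) => [k|] ->; first by rewrite vconsS; exact: h.
  by rewrite vcons0; move: h0; rewrite /= in_itv.
transitivity ((@lebesgue_measure R \x lebesgue_vec n)%E (`[a ord0, b ord0]%classic `*`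
    [set x : 'cV[R]_n | forall i : 'I_n, a (lift ord0 i) <= x i 0 <= b (lift ord0 i)])).
  by rewrite -E.
rewrite product_measure1E//; last exact: mbox.
congr (_ * _)%E; apply: etrans (lebesgue_measure_itv _) _ => /=.
rewrite lte_fin -EFinB.
by have := ab ord0; rewrite le_eqVlt => /predU1P[->|->//]; rewrite ltxx subrr.
Qed.

End lebesgue_vector.

Section complex_functions.
Context (R : realType) (n : nat).
Implicit Types (f g : 'cV[R]_n -> R[i]) (x y xi : 'cV[R]_n).

Definition dotv x y : R := \sum_i x i 0 * y i 0.

Definition enorm x : R := Num.sqrt (dotv x x).

(* for f not integrable, the junk value of [Rintegral] is inherited *)
Definition cintegral f : R[i] :=
  (\int[lebesgue_vec R n]_x complex.Re (f x)) +i*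
  (\int[lebesgue_vec R n]_x complex.Im (f x)).

Definition cinner f g : R[i] := cintegral (fun x => f x * (g x)^*).

Definition L2norm f : \bar R :=
  Lnorm (lebesgue_vec R n) 2%:E (fun x => (Normc.normc (f x))%:E).

Definition in_L2 f : Prop :=
  [/\ measurable_fun setT (fun x => complex.Re (f x)),
      measurable_fun setT (fun x => complex.Im (f x)) & (L2norm f < +oo)%E].

(* Operator norm on L^2 of an operator given by its graph; it is +oo when the
   operator is unbounded or not defined on all of L^2. *)
Definition L2_opnorm
    (T : ('cV[R]_n -> R[i]) -> ('cV[R]_n -> R[i]) -> Prop) : \bar R :=
  ereal_inf [set C%:E | C in [set C : R | 0 <= C /\
    forall f, in_L2 f -> exists g,
      [/\ in_L2 g, T f g & (L2norm g <= C%:E * L2norm f)%E]]].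

Definition cexpi (t : R) : R[i] := cos t +i* sin t.

Definition fourier f xi : R[i] :=
  cintegral (fun x => f x * cexpi (- (2 * pi * dotv x xi))).

Definition tsupport f : set 'cV[R]_n := closure [set x | f x != 0].

Definition radial f : Prop := forall x y, enorm x = enorm y -> f x = f y.

Definition monomial (alpha : 'I_n -> nat) x : R := \prod_i x i 0 ^+ alpha i.

(* iterated partial derivatives, along the list s of coordinate directions *)
Definition partials (s : seq 'I_n) (u : 'cV[R]_n -> R) : 'cV[R]_n -> R :=
  foldr (fun i (h : 'cV[R]_n -> R) => 'D_(delta_mx i 0) h) u s.

Definition smooth (u : 'cV[R]_n -> R) : Prop := forall s : seq 'I_n,
  continuous (partials s u) /\
  forall i x, derivable (partials s u) x (delta_mx i 0).

Definition schwartz_real (u : 'cV[R]_n -> R) : Prop :=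
  smooth u /\ forall (alpha : 'I_n -> nat) (s : seq 'I_n),
    exists M : R, forall x, `|monomial alpha x * partials s u x| <= M.

Definition schwartz f : Prop :=
  schwartz_real (fun x => complex.Re (f x)) /\ schwartz_real (fun x => complex.Im (f x)).

End complex_functions.

(* Below the dimension is n.+1, so that 'M[R]_n.+1 is a unit ring and integer
   powers [A ^ k] are available. *)
Section expansive_matrix.
Context (R : realType) (n : nat) (A : 'M[R]_n.+1).
Local Notation V := 'cV[R]_n.+1.

Definition complex_eigenvalue (mu : R[i]) : Prop :=
  eigenvalue (map_mx (real_complex R) A) mu.

Definition expansive : Prop :=
  forall mu, complex_eigenvalue mu -> 1 < Normc.normc mu.

Definition absdet : R := `|\det A|.

(* a minimum: the spectrum is finite and nonempty *)
Definition min_eigenvalue_modulus : R :=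
  inf [set Normc.normc mu | mu in complex_eigenvalue].

Definition open_ellipsoid (Delta : set V) : Prop :=
  exists2 P : 'M[R]_n.+1, P \in unitmx &
    Delta = [set P *m x | x in [set x : V | enorm x < 1]].

Definition expansive_ellipsoid (Delta : set V) : Prop :=
  [/\ open_ellipsoid Delta, lebesgue_vec R n.+1 Delta = 1%E &
      exists t : R, [/\ 1 < t, Delta `<=` [set t *: x | x in Delta] &
        [set t *: x | x in Delta] `<=` [set A *m x | x in Delta]]].

Definition dilated_ellipsoid (Delta : set V) (k : int) : set V :=
  [set A ^ k *m x | x in Delta].

(* the integer picked by [xget] is unique when A and Delta satisfy
   [expansive_ellipsoid] *)
Definition step_norm (Delta : set V) (x : V) : R :=
  if x == 0 then 0 else
  absdet ^ xget 0 [set k : int | dilated_ellipsoid Delta (k + 1) x /\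
                                 ~ dilated_ellipsoid Delta k x].

Definition anisotropic_annulus (Delta : set V) (rA RA : R) : set V :=
  [set xi | rA <= step_norm Delta xi <= RA].

Definition moment_order (p : R) : int :=
  Num.floor ((p^-1 - 1) * (ln absdet / ln min_eigenvalue_modulus)).

Definition vanishing_moments (psi : V -> R[i]) : Prop :=
  forall p : R, 0 < p <= 1 -> forall alpha : 'I_n.+1 -> nat,
    (\sum_i alpha i)%N%:Z <= moment_order p ->
    cintegral (fun x => (monomial alpha x)%:C * psi x) = 0.

Definition punctured_cube : set V :=
  [set xi | (forall i, - 2^-1 <= xi i 0 <= 2^-1) /\ xi <> 0].

Definition admissible (Delta : set V) (psi : V -> R[i]) : Prop :=
  [/\ schwartz psi, vanishing_moments psi &
      exists rA RA : R, [/\ 0 < rA, rA < RA,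
        tsupport (fourier psi) `<=` anisotropic_annulus Delta rA RA &
        anisotropic_annulus Delta rA RA `<=` punctured_cube]].

Definition affine (psi : V -> R[i]) (j : int) (k : 'cV[int]_n.+1) (x : V) :
    R[i] :=
  (absdet `^ (j%:~R / 2))%:C * psi (A ^ j *m x - map_mx intr k).

(* [frame_op psi f g]: the double series defining U_{psi,psi} f converges
   unconditionally in L^2, with sum g *)
Definition frame_op (psi f g : V -> R[i]) : Prop :=
  in_L2 g /\
  (fun F : {fset int * 'cV[int]_n.+1} =>
     L2norm (fun x => g x - \sum_(jk <- F)
       cinner f (affine psi jk.1 jk.2) * affine psi jk.1 jk.2 x))
    @ summability.totally --> 0%E.

Definition frame_op_sub_id (psi f h : V -> R[i]) : Prop :=
  exists2 g, frame_op psi f g & h = (fun x => g x - f x).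

Definition radial_class (Delta : set V) (r0 r1 : R) : set (V -> R[i]) :=
  [set psi | [/\ radial psi, admissible Delta psi &
    tsupport (fourier psi) `<=` [set xi | r0 <= enorm xi <= r1]]].

Definition epsilon2 (Delta : set V) (r0 r1 : R) : \bar R :=
  ereal_inf [set L2_opnorm (frame_op_sub_id psi)
            | psi in radial_class Delta r0 r1].

End expansive_matrix.

(* Main.v *)
Require Import Defs.
From mathcomp Require Import all_boot all_order all_algebra finmap complex.
From mathcomp Require Import all_classical all_reals all_analysis.
From mathcomp Require Import measurable_realfun ring lra.

Import Order.TTheory GRing.Theory Num.Theory.
Import numFieldNormedType.Exports.

Local Open Scope classical_set_scope.
Local Open Scope ring_scope.

(** Since [A^T v = lambda v] with [|lambda| > r1 / r0], some multiple [w] of [v]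
    has all its iterates [(A^T)^j w], [j] in Z, outside the shell
    [r0 <= |xi| <= r1]; as [A^T] is expansive, this persists on a small cube [W]
    around [w].  The inverse Fourier transform of [1_W] is therefore orthogonal
    to every [psi_{j,k}] (Fubini, no Plancherel needed), so [U] kills it and
    [||U - Id|| >= 1] for each [psi] of the class.  Conversely [psi = 0] belongs
    to the class and gives [U = 0]. *)

(** * Invariance of Lebesgue measure on column vectors *)

(** The test function must be square integrable, nonzero and orthogonal to every [affine A psi j k].
    Taking [W] to be a cube makes its inverse Fourier transform a product of one-dimensional sinc
    functions: each is bounded, decays like 1/t and is nonzero near 0. It is square integrable but
    not integrable, so in the Fubini exchange [psi] is the integrable factor and [W] the factor of
    finite measure. The change of variables x -> A^j x - k only has to carry zeros of a Fourier
    transform to zeros. Its Jacobian is therefore kept as an unspecified finite constant, whose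
    existence follows from translation invariance. The geometric obstacle is uniformity in j: one
    fixed cube has to work although the forward iterates of A^T spread it out. *)

Section vector_measurability.
Context {R : realType} {d} {T : measurableType d}.

Lemma measurable_coord {n} (f : T -> 'cV[R]_n) (i : 'I_n) :
  measurable_fun setT f -> measurable_fun setT (fun x => f x i 0).
Proof. by move=> mf; exact: measurableT_comp (measurable_vcoord i) mf. Qed.

Lemma measurable_vecB {n} (f g : T -> 'cV[R]_n) :
  measurable_fun setT f -> measurable_fun setT g ->
  measurable_fun setT (fun x => f x - g x).
Proof.
move=> mf mg; apply: measurable_fun_vecP => i.
rewrite (_ : _ \o _ = (fun x => f x i 0 - g x i 0)).
  by apply: measurable_funB; exact: measurable_coord.
by apply/funext => x; rewrite /= /vcoord !mxE.
Qed.

Lemma measurable_mulmx {m n} (M : 'M[R]_(m, n)) (f : T -> 'cV[R]_n) :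
  measurable_fun setT f -> measurable_fun setT (fun x => M *m f x).
Proof.
move=> mf; apply: measurable_fun_vecP => i.
rewrite (_ : _ \o _ = (fun x => \sum_j M i j * f x j 0)).
  apply: measurable_sum => j; apply: measurable_funM => //.
  exact: measurable_coord.
by apply/funext => x; rewrite /= /vcoord !mxE.
Qed.

Lemma measurable_dotv {n} (f g : T -> 'cV[R]_n) :
  measurable_fun setT f -> measurable_fun setT g ->
  measurable_fun setT (fun x => dotv (f x) (g x)).
Proof.
move=> mf mg; apply: measurable_sum => j; apply: measurable_funM;
exact: measurable_coord.
Qed.

End vector_measurability.

Section invariance.
Context {R : realType}.

Lemma measurable_reflect (a : R) :
  measurable_fun setT (fun t : measurableTypeR R => a - t : measurableTypeR R).
Proof. exact: measurable_funB. Qed.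

Lemma lebesgue_measure_reflect (a : R) (A : set (measurableTypeR R)) :
  measurable A ->
  lebesgue_measure ((fun t : measurableTypeR R => a - t) @^-1` A) =
  lebesgue_measure A.
Proof.
move=> mA.
have mr := measurable_reflect a.
pose m := measure_function_pushforward__canonical__measure_function_Measure
  (@lebesgue_measure R) mr.
transitivity (m A) => //; apply/esym.
have K := @lebesgue_measure_unique R m _ A mA.
apply: K => _ [[x y] _ <-] /=.
(* The generators are the intervals []x, y]]; the reflection moves the closed end to the left and
   keeps the length. *)
rewrite /pushforward (_ : _ @^-1` _ = `[a - y, a - x[%classic); last first.
  by apply/seteqP; split => t /=; rewrite !in_itv/= => /andP[? ?]; apply/andP; split; lra.
rewrite !lebesgue_measure_itv/= !lte_fin ltrD2l ltrN2; case: ifP => // _.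
by rewrite -!EFinB; congr EFin; ring.
Qed.

Lemma measurable_vec_reflect {n} (a : 'cV[R]_n) :
  measurable_fun setT (fun x : 'cV[R]_n => a - x).
Proof. exact: measurable_vecB. Qed.

(** Reflections come before translations: the Haar argument below substitutes [T z - x] for [x], and
    a translation is a composition of two reflections. They act coordinatewise, so uniqueness of the
    product measure reduces dimension [n.+1] to the line and dimension [n]. *)
Lemma lebesgue_vec_reflect {n} (a : 'cV[R]_n) (A : set 'cV[R]_n) :
  measurable A ->
  lebesgue_vec R n ((fun x => a - x) @^-1` A) = lebesgue_vec R n A.
Proof.
elim: n a A => [|n IH] a A mA.
  congr (_ _); apply/seteqP; split => x /=; congr A; apply/colP => -[] //.
pose r (p : measurableTypeR R * 'cV[R]_n) : measurableTypeR R * 'cV[R]_n :=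
  (a ord0 0 - p.1, vtail a - p.2).
have mr : measurable_fun setT r.
  apply/measurable_fun_pairP; split; rewrite /comp /=.
    exact: measurable_funB.
  exact: measurable_vecB.
pose mu12 := (@lebesgue_measure R \x lebesgue_vec R n)%E.
have E X : measurable X -> mu12 X = pushforward mu12 r X.
  apply: product_measure_unique => // B C mB mC.
  rewrite /= /pushforward (_ : _ @^-1` _ =
    ((fun t => a ord0 0 - t) @^-1` B) `*` ((fun x => vtail a - x) @^-1` C)) //.
  rewrite /mu12 product_measure1E.
  - by congr (_ * _)%E; [exact: lebesgue_measure_reflect|exact: IH].
  - rewrite -[X in measurable X]setTI.
    exact: measurable_reflect.
  - rewrite -[X in measurable X]setTI; exact: (measurable_vec_reflect (vtail a)).
transitivity (pushforward mu12 r (@vcons R n @^-1` A)); last first.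
  rewrite -E //= -[X in measurable X]setTI; exact: measurable_vcons.
rewrite /= /pushforward /lebesgue_step /pushforward /=.
congr (mu12 _); apply/seteqP; split => p /=; congr A; apply/colP => i;
  rewrite !mxE; case: unliftP => [j|] -> //=; by rewrite !mxE.
Qed.

Lemma lebesgue_vec_shift {n} (a : 'cV[R]_n) (A : set 'cV[R]_n) :
  measurable A ->
  lebesgue_vec R n ((fun x => x - a) @^-1` A) = lebesgue_vec R n A.
Proof.
move=> mA; rewrite -[RHS](lebesgue_vec_reflect 0) //.
rewrite -[RHS](lebesgue_vec_reflect a).
  by congr (_ _); apply/seteqP; split => x /=; rewrite sub0r opprB.
rewrite -[X in measurable X]setTI; exact: measurable_vec_reflect.
Qed.

Lemma ge0_integral_reflect {n} (a : 'cV[R]_n) (f : 'cV[R]_n -> \bar R) :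
  measurable_fun setT f -> (forall x, 0 <= f x)%E ->
  (\int[lebesgue_vec R n]_x f (a - x)%R = \int[lebesgue_vec R n]_x f x)%E.
Proof.
move=> mf f0; have mr := measurable_vec_reflect a.
transitivity (\int[pushforward (lebesgue_vec R n) (fun x => a - x)%R]_x f x)%E.
  by rewrite (ge0_integral_pushforward mr) // => x _.
apply: eq_measure_integral => B mB _; exact: lebesgue_vec_reflect.
Qed.

End invariance.

(** * Uniqueness of translation-invariant measures *)

Section change_of_variables.
Context {R : realType} {n : nat}.
Let mu := lebesgue_vec R n.
Context (T : 'cV[R]_n -> 'cV[R]_n).
Hypothesis mT : measurable_fun setT T.
Hypothesis T_shift : forall x (B : set 'cV[R]_n), measurable B ->
  mu ((fun z => T z - x) @^-1` B) = mu (T @^-1` B).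

(* Weil's uniqueness argument for Haar measure: integrate
   [1_E(x) 1_B(T z - x)] in both orders. *)
Lemma haar_uniqueness (E B : set 'cV[R]_n) : measurable E -> measurable B ->
  (mu E * mu (T @^-1` B) = mu (T @^-1` E) * mu B)%E.
Proof.
move=> mE mB.
pose g (p : 'cV[R]_n * 'cV[R]_n) : \bar R := (\1_E p.1 * \1_B (T p.2 - p.1))%:E.
pose h (p : 'cV[R]_n * 'cV[R]_n) : \bar R := (\1_E (T p.1 - p.2) * \1_B p.2)%:E.
have mind (d0 : measure_display) (X : measurableType d0) (C : set 'cV[R]_n)
    (f : X -> 'cV[R]_n) : measurable C -> measurable_fun setT f ->
    measurable_fun setT (fun x => \1_C (f x) : R).
  by move=> mC mf; apply: measurableT_comp mf; exact: measurable_indic.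
have msub (d0 : measure_display) (X : measurableType d0) (u v : X -> 'cV[R]_n) :
    measurable_fun setT u -> measurable_fun setT v ->
    measurable_fun setT (fun x => T (u x) - v x).
  by move=> mu' mv; apply: measurable_vecB => //; exact: measurableT_comp.
have mg : measurable_fun setT g.
  apply/measurable_EFinP; apply: measurable_funM; apply: mind => //.
  exact: msub.
have mh : measurable_fun setT h.
  apply/measurable_EFinP; apply: measurable_funM; apply: mind => //.
  exact: msub.
have g0 p : (0 <= g p)%E by rewrite lee_fin mulr_ge0.
have h0 p : (0 <= h p)%E by rewrite lee_fin mulr_ge0.
have preT C : measurable C -> measurable (T @^-1` C).
  by move=> mC; rewrite -[X in measurable X]setTI; exact: mT.
have preTs C x : measurable C -> measurable ((fun z => T z - x) @^-1` C).
  move=> mC; rewrite -[X in measurable X]setTI.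
  have mS : measurable_fun setT (fun z => T z - x) by exact: measurable_vecB.
  exact: mS.
transitivity (\int[mu]_x \int[mu]_z g (x, z))%E.
  transitivity (\int[mu]_x ((\1_E x)%:E * mu (T @^-1` B)))%E.
    rewrite ge0_integralZr //.
    - by rewrite integral_indic // setIT.
    - by apply/measurable_EFinP; exact: measurable_indic.
  apply: eq_integral => x _; rewrite -(T_shift x) //.
  rewrite /g /=; under eq_integral do rewrite EFinM.
  rewrite ge0_integralZl //; last first.
    by apply/measurable_EFinP; apply: mind => //; exact: msub.
  congr (_ * _)%E.
  transitivity (\int[mu]_z (\1_((fun z => T z - x) @^-1` B) z)%:E)%E => //.
  by rewrite integral_indic ?setIT //; exact: preTs.
rewrite (fubini_tonelli g) //.
(* For fixed [z], replacing [x] by [T z - x] turns [g] into [h], which exchanges the roles of [E]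
   and [B]. *)
transitivity (\int[mu]_z \int[mu]_x h (z, x))%E.
  apply: eq_integral => z _.
  rewrite -[RHS](ge0_integral_reflect (T z)) //.
    by apply: eq_integral => x _; rewrite /g /h /= opprB addrCA subrr addr0.
  exact: measurableT_comp mh (measurable_pair1 z).
rewrite (fubini_tonelli h) //.
transitivity (\int[mu]_x (mu (T @^-1` E) * (\1_B x)%:E))%E; last first.
  rewrite ge0_integralZl //; first by rewrite integral_indic // setIT.
  by apply/measurable_EFinP; exact: measurable_indic.
apply: eq_integral => x _; rewrite -(T_shift x) //.
rewrite /h /=; under eq_integral do rewrite EFinM.
rewrite ge0_integralZr //; last first.
  by apply/measurable_EFinP; apply: mind => //; exact: msub.
congr (_ * _)%E.
transitivity (\int[mu]_z (\1_((fun z => T z - x) @^-1` E) z)%:E)%E => //.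
by rewrite integral_indic ?setIT //; exact: preTs.
Qed.

End change_of_variables.

(** * Affine changes of variables *)

Section affine_change_of_variables.
Context {R : realType}.

Definition box {n} (a b : 'I_n -> R) : set 'cV[R]_n :=
  [set x | forall i, a i <= x i 0 <= b i].

Lemma measurable_box {n} (a b : 'I_n -> R) : measurable (box a b).
Proof.
have -> : box a b = \big[setI/setT]_i (@vcoord R n i @^-1` `[a i, b i]).
  rewrite -bigcap_seq; apply/seteqP; split => x /= h i.
    by move=> _; rewrite /= in_itv/= /vcoord h.
  by have := h i (mem_index_enum _); rewrite /= in_itv.
apply: bigsetI_measurable => i _; rewrite -[X in measurable X]setTI.
exact: measurable_vcoord.
Qed.

Lemma lebesgue_box_lty {n} (a b : 'I_n -> R) : (lebesgue_vec R n (box a b) < +oo)%E.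
Proof.
have [ab|] := pselect (forall i, a i <= b i); first by rewrite lebesgue_vec_box ?ltry.
move=> /existsNP[i /negP nab]; rewrite (_ : box a b = set0) ?measure0 ?ltry //.
by apply/seteqP; split => x //= /(_ i) /andP[h1 h2]; rewrite (le_trans h1 h2) in nab.
Qed.

(** This is [haar_uniqueness] against the unit cube, whose measure is 1: [c] is the measure of the
    preimage of that cube. It stays existential because it will only multiply a vanishing Fourier
    integral or preserve integrability. *)
Lemma affine_change_of_variables {n} (M : 'M[R]_n) (k : 'cV[R]_n) : M \in unitmx ->
  exists c : {nonneg R}, forall E : set 'cV[R]_n, measurable E ->
    lebesgue_vec R n ((fun x => M *m x - k) @^-1` E) = (c%:num%:E * lebesgue_vec R n E)%E.
Proof.
move=> uM; pose T x := M *m x - k; pose mu := lebesgue_vec R n.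
have mT : measurable_fun setT T.
  by apply: measurable_vecB => //; exact: measurable_mulmx.
have mpre E : measurable E -> measurable (T @^-1` E).
  by move=> mE; rewrite -[X in measurable X]setTI; exact: mT.
(* Shifting [T z] by [x] amounts to shifting [z] by [invmx M *m x]. *)
have T_shift x (B : set 'cV[R]_n) : measurable B ->
    mu ((fun z => T z - x) @^-1` B) = mu (T @^-1` B).
  move=> mB; rewrite -[RHS](lebesgue_vec_shift (invmx M *m x)); last exact: mpre.
  congr (_ _); apply/seteqP; split => z /=; congr B;
    by rewrite /T mulmxBr mulmxA mulmxV // mul1mx addrAC.
pose B : set 'cV[R]_n := box (fun=> 0) (fun=> 1).
have mB : measurable B by exact: measurable_box.
have muB : mu B = 1%E.
  by rewrite /mu lebesgue_vec_box // big1 // => i _; rewrite subr0.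
have fin : mu (T @^-1` B) \is a fin_num.
  rewrite ge0_fin_numE //.
  (* Bounds the [i]-th coordinate of [invmx M *m (T x + k)] when [T x] lies in the unit cube, so the
     preimage sits in a box of finite measure. *)
  pose C i := \sum_j `|invmx M i j| * (1 + `|k j 0|).
  apply: le_lt_trans (lebesgue_box_lty (fun i => - C i) C).
  apply: le_measure; rewrite ?inE; [exact: mpre|exact: measurable_box|].
  move=> x Bx i; rewrite -ler_norml.
  have -> : x = invmx M *m (T x + k).
    by rewrite /T subrK mulmxA mulVmx // mul1mx.
  rewrite mxE (le_trans (ler_norm_sum _ _ _)) //.
  apply: ler_sum => j _; rewrite normrM ler_wpM2l // mxE.
  rewrite (le_trans (ler_normD _ _)) // lerD2r.
  by have /andP[h0 h1] := Bx j; rewrite ger0_norm.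
have c0 : 0 <= fine (mu (T @^-1` B)) by rewrite fine_ge0.
exists (NngNum c0) => E mE /=; rewrite fineK //.
by rewrite muleC (haar_uniqueness _ mT T_shift) // muB mule1.
Qed.

Lemma ge0_integral_affine {n} (M : 'M[R]_n) (k : 'cV[R]_n) : M \in unitmx ->
  exists c : {nonneg R}, forall f : 'cV[R]_n -> \bar R,
    measurable_fun setT f -> (forall x, 0 <= f x)%E ->
    (\int[lebesgue_vec R n]_x f (M *m x - k)%R =
     c%:num%:E * \int[lebesgue_vec R n]_x f x)%E.
Proof.
move=> uM; have [c cE] := affine_change_of_variables _ k uM.
exists c => f mf f0; rewrite -ge0_integral_mscale //.
have mT : measurable_fun setT (fun x => M *m x - k).
  by apply: measurable_vecB => //; exact: measurable_mulmx.
transitivity (\int[pushforward (lebesgue_vec R n) (fun x => M *m x - k)%R]_x f x)%E.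
  by rewrite (ge0_integral_pushforward mT) // => x _.
by apply: eq_measure_integral => E mE _; exact: cE.
Qed.

Lemma integral_affine {n} (M : 'M[R]_n) (k : 'cV[R]_n) : M \in unitmx ->
  exists c : R, forall u : 'cV[R]_n -> R,
    (lebesgue_vec R n).-integrable setT (EFin \o u) ->
    (lebesgue_vec R n).-integrable setT (EFin \o (fun x => u (M *m x - k))) /\
    \int[lebesgue_vec R n]_x u (M *m x - k) = c * \int[lebesgue_vec R n]_x u x.
Proof.
move=> uM; have [c cE] := ge0_integral_affine _ k uM.
exists c%:num => u iu; have mu := measurable_int _ iu.
have mT : measurable_fun setT (fun x => M *m x - k).
  by apply: measurable_vecB => //; exact: measurable_mulmx.
have iuT : (lebesgue_vec R n).-integrable setT (EFin \o (fun x => u (M *m x - k))).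
  apply/integrableP; split.
    exact: measurableT_comp mu mT.
  rewrite (cE (fun x => `|(u x)%:E|%E)) //; last exact: measurableT_comp.
  by move/integrableP : iu => [_ ?]; rewrite lte_mul_pinfty // ge0_fin_numE //.
split=> //; rewrite /Rintegral.
have -> : (\int[lebesgue_vec R n]_x (u (M *m x - k)%R)%:E =
    c%:num%:E * \int[lebesgue_vec R n]_x (u x)%:E)%E.
  rewrite integralE [in RHS]integralE muleBr //; last first.
    apply: fin_num_adde_defr; exact: integrable_pos_fin_num.
  have E f : (EFin \o u) = f -> (fun x => (u (M *m x - k))%:E) = f \o (fun x => M *m x - k).
    by move=> <-.
  rewrite (E _ erefl) funepos_comp funeneg_comp.
  by congr (_ - _)%E; apply: cE => //; [exact: measurable_funepos|exact: measurable_funeneg].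
by rewrite fineM //; exact: integrable_fin_num.
Qed.

End affine_change_of_variables.

(** * Measurability of continuous functions and of parametric integrals *)

Section measurability.
Context {R : realType}.

(** The sigma-algebra is generated by the coordinates and not by the open sets, so an open set is
    rewritten as a countable union of boxes with rational centres. *)
Lemma open_vec_measurable {n} (O : set 'cV[R]_n) : open O -> measurable O.
Proof.
move=> oO.
pose rbox (p : 'cV[rat]_n * nat) : set 'cV[R]_n :=
  box (fun i => ratr (p.1 i 0) - p.2.+1%:R^-1) (fun i => ratr (p.1 i 0) + p.2.+1%:R^-1).
(* Boxes not contained in [O] are replaced by the empty set, which lets the union range over a whole
   countable type. *)
have -> : O = \bigcup_p (if `[< rbox p `<=` O >] then rbox p else set0).
  apply/seteqP; split=> [x Ox|x [p _]]; last by case: ifP => [/asboolP|//]; apply.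
  have [e /= e0 xeO] : exists2 e : R, 0 < e & ball x e `<=` O.
    by apply/nbhs_ballP; exact: open_nbhs_nbhs.
  (* Half of [e] covers the distance from [x] to the rational centre, the other half the size of the
     box. *)
  have [k ke] : exists k : nat, k.+1%:R^-1 < e / 2.
    exists (Num.truncn (e / 2)^-1); rewrite invf_plt ?posrE ?divr_gt0 //.
    exact: truncnS_gt.
  set a : R := k.+1%:R^-1 in ke.
  have a0 : 0 < a by rewrite invr_gt0.
  have /choice[q qx] (i : 'I_n) : exists q : rat, `|ratr q - x i 0| < a.
    have [q] : exists q, ratr q \in `]x i 0 - a, x i 0 + a[.
      by apply: rat_in_itvoo; lra.
    by rewrite in_itv /= -ltr_distl => ?; exists q.
  have bx : rbox (\col_i q i, k) x.
    move=> i /=; rewrite mxE -/a; have := qx i; rewrite ltr_distl => /andP[? ?].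
    by apply/andP; split; lra.
  exists (\col_i q i, k) => //; case: ifPn => // /asboolPn[].
  move=> y /= yb; apply: xeO; split=> // i j; rewrite ord1 /ball /=.
  have := yb i; rewrite /= mxE -/a => /andP[? ?]; have := qx i.
  by rewrite ltr_distl ltr_norml => /andP[? ?]; apply/andP; split; lra.
apply: countable_bigcupT_measurable => [|p]; first exact: countableP.
by case: ifP => // _; exact: measurable_box.
Qed.

Lemma continuous_vec_measurable {n} (u : 'cV[R]_n -> R) :
  continuous u -> measurable_fun setT u.
Proof.
move=> /continuousP cu; apply: (measurability _ (RGenOpens.measurableE R)).
move=> _ [_ [a [b ->] <-]]; rewrite setTI; apply: open_vec_measurable.
exact/cu/interval_open.
Qed.

(** Tonelli gives measurability for the integrals of the positive and negative parts, whether or not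
    they are finite; the extended difference and [fine] preserve it. *)
Lemma measurable_Rintegral {d1 d2} {X : measurableType d1} {Y : measurableType d2}
    (m : {sigma_finite_measure set Y -> \bar R}) (K : X * Y -> R) :
  measurable_fun setT K -> measurable_fun setT (fun x => \int[m]_y K (x, y)).
Proof.
move=> mK; have mEK : measurable_fun setT (EFin \o K) by exact/measurable_EFinP.
apply: measurableT_comp => //.
have -> : (fun x => \int[m]_y (K (x, y))%:E)%E =
    (fun x => \int[m]_y (EFin \o K)^\+ (x, y) - \int[m]_y (EFin \o K)^\- (x, y))%E.
  apply/funext => x; rewrite integralE; congr (_ - _)%E.
    by apply: eq_integral => y _; rewrite -[RHS]/((_ \o (fun y => (x, y))) y) -funepos_comp.
  by apply: eq_integral => y _; rewrite -[RHS]/((_ \o (fun y => (x, y))) y) -funeneg_comp.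
apply: emeasurable_funB.
  by apply: measurable_fun_fubini_tonelli_F => //; exact: measurable_funepos.
by apply: measurable_fun_fubini_tonelli_F => //; exact: measurable_funeneg.
Qed.

Lemma measurable_cos : measurable_fun setT (@cos R).
Proof. exact: continuous_measurable_fun (@continuous_cos R). Qed.

Lemma measurable_sin : measurable_fun setT (@sin R).
Proof. exact: continuous_measurable_fun (@continuous_sin R). Qed.

End measurability.

(** * Product functions *)

Section tensor_products.
Context {R : realType}.
Local Notation leb := (@lebesgue_measure R).

Lemma ge0_integral_vcons {n} (w : 'cV[R]_n.+1 -> \bar R) :
  measurable_fun setT w -> (forall x, 0 <= w x)%E ->
  (\int[lebesgue_vec R n.+1]_x w x =
   \int[(leb \x lebesgue_vec R n)%E]_p w (vcons p))%E.
Proof.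
move=> mw w0.
transitivity (\int[pushforward (leb \x lebesgue_vec R n)%E (@vcons R n)]_x w x)%E.
  apply: eq_measure_integral => [|A mA _ //]; exact: measurable_vcons.
by rewrite (ge0_integral_pushforward (@measurable_vcons R n)).
Qed.

Definition tensor {n} (u : R -> R) (w : 'cV[R]_n -> R) (x : 'cV[R]_n.+1) : R :=
  u (x ord0 0) * w (vtail x).

Lemma integrable_tensor_prod {n} (u : measurableTypeR R -> R) (w : 'cV[R]_n -> R) :
  leb.-integrable setT (EFin \o u) ->
  (lebesgue_vec R n).-integrable setT (EFin \o w) ->
  (leb \x lebesgue_vec R n)%E.-integrable setT (fun p => (u p.1 * w p.2)%:E).
Proof.
move=> iu iw.
have mu : measurable_fun setT u by have /measurable_EFinP := measurable_int _ iu.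
have mw : measurable_fun setT w by have /measurable_EFinP := measurable_int _ iw.
apply/integrable12ltyP => /=.
  apply/measurable_EFinP; apply: measurable_funM.
    exact: measurableT_comp mu measurable_fst.
  exact: measurableT_comp mw measurable_snd.
rewrite (_ : (fun x => _) = (fun x => (`|u x|%:E * \int[lebesgue_vec R n]_y `|(w y)%:E|)%E)); last first.
  apply/funext => x; under eq_integral do rewrite normrM EFinM.
  by rewrite ge0_integralZl //; do 2 apply: measurableT_comp => //.
rewrite ge0_integralZr //; last first.
  by apply: integral_ge0.
  by do 2 apply: measurableT_comp => //.
apply: lte_mul_pinfty.
- exact: integral_ge0.
- by rewrite ge0_fin_numE ?integral_ge0 //; move/integrableP : iu => [].
- by move/integrableP : iw => [].
Qed.

Lemma integrable_tensor {n} (u : measurableTypeR R -> R) (w : 'cV[R]_n -> R) :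
  leb.-integrable setT (EFin \o u) ->
  (lebesgue_vec R n).-integrable setT (EFin \o w) ->
  (lebesgue_vec R n.+1).-integrable setT (EFin \o tensor u w).
Proof.
move=> iu iw.
have mu : measurable_fun setT u by have /measurable_EFinP := measurable_int _ iu.
have mw : measurable_fun setT w by have /measurable_EFinP := measurable_int _ iw.
have mt : measurable_fun setT (tensor u w).
  apply: measurable_funM.
    exact: measurableT_comp mu (measurable_vcoord ord0).
  exact: measurableT_comp mw (@measurable_vtail R n).
apply/integrableP; split; first exact/measurable_EFinP.
rewrite ge0_integral_vcons //; last first.
  by do 2 apply: measurableT_comp => //.
have /integrableP[_] := integrable_tensor_prod u w iu iw.
congr (_ < _)%E; apply: eq_integral => p _.
by rewrite /= /tensor vcons0 vtail_cons.
Qed.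

Lemma Rintegral_tensor {n} (u : measurableTypeR R -> R) (w : 'cV[R]_n -> R) :
  leb.-integrable setT (EFin \o u) ->
  (lebesgue_vec R n).-integrable setT (EFin \o w) ->
  \int[lebesgue_vec R n.+1]_x tensor u w x =
  (\int[leb]_t u t) * \int[lebesgue_vec R n]_y w y.
Proof.
move=> iu iw.
have mu : measurable_fun setT u by have /measurable_EFinP := measurable_int _ iu.
have mw : measurable_fun setT w by have /measurable_EFinP := measurable_int _ iw.
have it := integrable_tensor u w iu iw.
have ip := integrable_tensor_prod u w iu iw.
have E : (fun p => (u p.1 * w p.2)%:E) = (EFin \o tensor u w) \o @vcons R n.
  by apply/funext => p; rewrite /= /tensor vcons0 vtail_cons.
rewrite /Rintegral.
have -> : (\int[lebesgue_vec R n.+1]_x (tensor u w x)%:E =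
    \int[(leb \x lebesgue_vec R n)%E]_p (u p.1 * w p.2)%:E)%E.
  transitivity (\int[pushforward (leb \x lebesgue_vec R n)%E (@vcons R n)]_x
     (tensor u w x)%:E)%E.
    apply: eq_measure_integral => [|A mA _ //]; exact: measurable_vcons.
  rewrite (integral_pushforward (@measurable_vcons R n)) //.
  - by rewrite preimage_setT E.
  - exact: measurable_int it.
  - by rewrite preimage_setT -E.
rewrite -integral12_prod_meas1 //=.
have -> : (\int[leb]_t fubini_F (lebesgue_vec R n) (fun p => (u p.1 * w p.2)%:E) t =
    \int[leb]_t ((u t)%:E * \int[lebesgue_vec R n]_y (w y)%:E))%E.
  apply: eq_integral => t _; rewrite /fubini_F /=.
  by under eq_integral do rewrite EFinM; rewrite integralZl.
have /fineK <- : (\int[lebesgue_vec R n]_y (w y)%:E)%E \is a fin_num.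
  exact: integrable_fin_num.
rewrite integralZr //.
by rewrite fineM //; exact: integrable_fin_num.
Qed.

End tensor_products.

(** * Integrability of Schwartz functions *)

Section decay.
Context {R : realType}.
Local Notation leb := (@lebesgue_measure R).

(** The integrand is even, and its integral over the half line is the limit of an arctangent. *)
Lemma integrable_oneDsqrV :
  leb.-integrable setT (EFin \o (fun t : R => (oneDsqr t)^-1)).
Proof.
have m : measurable_fun setT (fun t : R => (oneDsqr t)^-1).
  exact: continuous_measurable_fun (@continuous_oneDsqrV R).
have ge0 (t : R) : 0 <= (oneDsqr t)^-1 by rewrite invr_ge0.
apply/integrableP; split; first exact/measurable_EFinP.
under eq_integral do rewrite /= ger0_norm //.
rewrite (@ge0_symfun_integralT _ (fun t => (oneDsqr t)^-1)) //.
- rewrite (_ : [set x : R | (0 <= x)%R] = `[0, +oo[%classic); last first.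
    by apply/seteqP; split => x/=; rewrite in_itv/= andbT.
  by rewrite integral0y_oneDsqr -EFinM ltry.
- exact: continuous_oneDsqrV.
- by move=> t /=; rewrite /oneDsqr sqrrN.
Qed.

(** A product over coordinates instead of a power of [enorm]: as an iterated [tensor] it is
    integrable by induction on the dimension, and it is also the shape of the bound on the squared
    modulus of [band]. *)
Definition decay {n} (x : 'cV[R]_n) : R := \prod_i (oneDsqr (x i 0))^-1.

Lemma integrable_cst_vec0 (r : R) : (lebesgue_vec R 0).-integrable setT (EFin \o cst r).
Proof.
apply/integrableP; split; first exact/measurable_EFinP.
rewrite (eq_integral (cst `|r|%:E)) //.
by rewrite integral_cst //= diracT mule1 ltry.
Qed.

Lemma integrable_decay n : (lebesgue_vec R n).-integrable setT (EFin \o decay).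
Proof.
elim: n => [|n IH].
  rewrite (_ : decay = cst 1); last by apply/funext => x; rewrite /decay big_ord0.
  exact: integrable_cst_vec0.
rewrite (_ : decay = tensor (fun t => (oneDsqr t)^-1) decay).
  by apply: integrable_tensor => //; exact: integrable_oneDsqrV.
apply/funext => x; rewrite /tensor /decay big_ord_recl; congr (_ * _).
by apply: eq_bigr => i _; rewrite mxE.
Qed.

(** Each factor [1 + x_i ^ 2] of the reciprocal of [decay] is a sum of two monomials, so the
    Schwartz bounds absorb one coordinate at a time. *)
Lemma schwartz_decay {n} (u : 'cV[R]_n -> R) : schwartz_real u ->
  exists M : R, forall x, `|u x| <= M * decay x.
Proof.
move=> [_ hu].
(* [alpha] is generalized since absorbing coordinate [i] raises its exponent by 2. *)
have key (s : seq 'I_n) : forall alpha : 'I_n -> nat, exists M : R, forall x,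
    `|monomial alpha x| * \prod_(i <- s) oneDsqr (x i 0) * `|u x| <= M.
  elim: s => [|i s IH] alpha.
    have [M HM] := hu alpha [::]; exists M => x.
    by rewrite big_nil mulr1 -normrM; exact: HM.
  have [M1 H1] := IH alpha.
  have [M2 H2] := IH (fun j => alpha j + 2 * (j == i))%N.
  exists (M1 + M2) => x; rewrite big_cons.
  have -> : `|monomial alpha x| * (oneDsqr (x i 0) * \prod_(j <- s) oneDsqr (x j 0)) * `|u x| =
      `|monomial alpha x| * \prod_(j <- s) oneDsqr (x j 0) * `|u x| +
      (`|monomial alpha x| * x i 0 ^+ 2) * \prod_(j <- s) oneDsqr (x j 0) * `|u x|.
    by rewrite /oneDsqr; ring.
  apply: lerD; first exact: H1.
  have -> : `|monomial alpha x| * x i 0 ^+ 2 =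
      `|monomial (fun j => alpha j + 2 * (j == i))%N x|.
    rewrite /monomial; under [in RHS]eq_bigr do rewrite exprD.
    rewrite big_split /= normrM; congr (_ * _).
    rewrite (bigD1 i) //= eqxx muln1 big1 ?mulr1; last first.
      by move=> j /negbTE ->; rewrite muln0 expr0.
    by rewrite ger0_norm // sqr_ge0.
  exact: H2.
have [M HM] := key (enum 'I_n) (fun=> 0%N); exists M => x.
have := HM x; rewrite /monomial big1 ?normr1 ?mul1r; last by move=> i _; rewrite expr0.
rewrite big_enum /= => h.
by rewrite /decay prodfV ler_pdivlMr 1?mulrC //; exact: prodr_gt0.
Qed.

Lemma integrable_schwartz {n} (u : 'cV[R]_n -> R) : schwartz_real u ->
  (lebesgue_vec R n).-integrable setT (EFin \o u).
Proof.
move=> su; have [M uM] := schwartz_decay u su.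
have mu : measurable_fun setT u.
  by apply: continuous_vec_measurable; case: su => /(_ [::])[].
apply: (@le_integrable _ _ _ _ _ measurableT _ (fun x => (M%:E * (decay x)%:E)%E)).
- exact/measurable_EFinP.
- by move=> x _ /=; rewrite lee_fin (le_trans (uM x)) // ler_norm.
- by apply: integrableZl => //; exact: integrable_decay.
Qed.

End decay.

(** * Complex-valued integrals of product functions *)

Section complex_integration.
Context {R : realType}.
Local Open Scope complex_scope.
Local Notation leb := (@lebesgue_measure R).
Local Notation ReC := (@complex.Re R).
Local Notation ImC := (@complex.Im R).

Lemma ReM (z w : R[i]) : ReC (z * w) = ReC z * ReC w - ImC z * ImC w.
Proof. by case: z w => [a b] [c d]. Qed.

Lemma ImM (z w : R[i]) : ImC (z * w) = ReC z * ImC w + ImC z * ReC w.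
Proof. by case: z w => [a b] [c d]. Qed.

Definition cintegrable {n} (h : 'cV[R]_n -> R[i]) :=
  (lebesgue_vec R n).-integrable setT (EFin \o (fun x => ReC (h x))) /\
  (lebesgue_vec R n).-integrable setT (EFin \o (fun x => ImC (h x))).

Lemma integrable_scale {n} (r : R) (u : 'cV[R]_n -> R) :
  (lebesgue_vec R n).-integrable setT (EFin \o u) ->
  (lebesgue_vec R n).-integrable setT (EFin \o (fun x => r * u x)).
Proof. by move=> iu; exact: (integrableZl measurableT r iu). Qed.

Lemma cintegralZ {n} (z : R[i]) (h : 'cV[R]_n -> R[i]) : cintegrable h ->
  cintegral (fun x => z * h x) = z * cintegral h.
Proof.
move=> [h1 h2]; rewrite /cintegral.
under eq_Rintegral do rewrite ReM.
under [X in _ +i* X]eq_Rintegral do rewrite ImM.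
have Z := @integrable_scale n.
rewrite RintegralB ?RintegralD ?RintegralZl //; try exact: Z.
by case: z.
Qed.

Definition cintegral1 (a : R -> R[i]) : R[i] :=
  (\int[leb]_t ReC (a t)) +i* (\int[leb]_t ImC (a t)).

Definition cintegrable1 (a : R -> R[i]) :=
  leb.-integrable setT (EFin \o (fun t : measurableTypeR R => ReC (a t))) /\
  leb.-integrable setT (EFin \o (fun t : measurableTypeR R => ImC (a t))).

Lemma cintegral_tensor {n} (a : R -> R[i]) (w : 'cV[R]_n -> R[i]) :
  cintegrable1 a -> cintegrable w ->
  cintegrable (fun x : 'cV[R]_n.+1 => a (x ord0 0) * w (vtail x)) /\
  cintegral (fun x : 'cV[R]_n.+1 => a (x ord0 0) * w (vtail x)) =
  cintegral1 a * cintegral w.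
Proof.
move=> [a1 a2] [w1 w2].
pose t11 := tensor (ReC \o a) (ReC \o w); pose t22 := tensor (ImC \o a) (ImC \o w).
pose t12 := tensor (ReC \o a) (ImC \o w); pose t21 := tensor (ImC \o a) (ReC \o w).
have i11 : (lebesgue_vec R n.+1).-integrable setT (EFin \o t11) by exact: integrable_tensor.
have i22 : (lebesgue_vec R n.+1).-integrable setT (EFin \o t22) by exact: integrable_tensor.
have i12 : (lebesgue_vec R n.+1).-integrable setT (EFin \o t12) by exact: integrable_tensor.
have i21 : (lebesgue_vec R n.+1).-integrable setT (EFin \o t21) by exact: integrable_tensor.
have reE : (fun x : 'cV[R]_n.+1 => ReC (a (x ord0 0) * w (vtail x))) = t11 \- t22.
  by apply/funext => x; rewrite ReM.
have imE : (fun x : 'cV[R]_n.+1 => ImC (a (x ord0 0) * w (vtail x))) = t12 \+ t21.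
  by apply/funext => x; rewrite ImM.
rewrite /cintegrable /cintegral reE imE; split.
  by split; [exact: (integrableB _ i11 i22)|exact: (integrableD _ i12 i21)].
rewrite RintegralB // RintegralD // !Rintegral_tensor //.
Qed.

Lemma cintegral_prod {n} (a : 'I_n -> R -> R[i]) :
  (forall i, cintegrable1 (a i)) ->
  cintegrable (fun x : 'cV[R]_n => \prod_i a i (x i 0)) /\
  cintegral (fun x : 'cV[R]_n => \prod_i a i (x i 0)) = \prod_i cintegral1 (a i).
Proof.
elim: n a => [|n IH] a ia.
  have -> : (fun x : 'cV[R]_0 => \prod_i a i (x i 0)) = cst 1.
    by apply/funext => x; rewrite big_ord0.
  split; first by split; exact: integrable_cst_vec0.
  (* [lebesgue_vec R 0] is a Dirac mass, so the integral of 1 equals the empty product. *)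
  rewrite big_ord0 /cintegral /= !Rintegral_cst //=.
  by rewrite indicT mulr1 mul0r.
have -> : (fun x : 'cV[R]_n.+1 => \prod_i a i (x i 0)) =
    (fun x => a ord0 (x ord0 0) * (fun y => \prod_i a (lift ord0 i) (y i 0)) (vtail x)).
  apply/funext => x; rewrite big_ord_recl; congr (_ * _).
  by apply: eq_bigr => i _; rewrite mxE.
have [iw wE] := IH (fun i => a (lift ord0 i)) (fun i => ia _).
have [? ->] := cintegral_tensor _ _ (ia ord0) iw.
by split=> //; rewrite big_ord_recl wE.
Qed.

End complex_integration.

Section character.
Context {R : realType}.
Local Open Scope complex_scope.

Lemma cexpi0 : cexpi (0 : R) = 1.
Proof. by rewrite /cexpi cos0 sin0. Qed.

Lemma cexpiD (s t : R) : cexpi (s + t) = cexpi s * cexpi t.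
Proof. by rewrite /cexpi cosD sinD; simpc; congr (_ +i* _); rewrite addrC. Qed.

Lemma cexpi_sum (I : Type) (r : seq I) (F : I -> R) :
  cexpi (\sum_(i <- r) F i) = \prod_(i <- r) cexpi (F i).
Proof.
apply: (big_morph (@cexpi R) _ cexpi0) => s t; exact: cexpiD.
Qed.

End character.

(** * Windowed characters on the line *)

Section window.
Context {R : realType}.
Local Open Scope complex_scope.
Local Notation leb := (@lebesgue_measure R).
Local Notation ReC := (@complex.Re R).
Local Notation ImC := (@complex.Im R).

(** Its integral over [s] is a modulated sinc in the frequency [t], namely exp(2 pi i t c) sin(2 pi
    t d) / (pi t) away from [t = 0]. *)
Definition window (c d t s : R) : R[i] :=
  (\1_(`[c - d, c + d]%classic) s)%:C * cexpi (2 * pi * (t * s)).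

Lemma Re_window (c d t s : R) : ReC (window c d t s) =
  \1_(`[c - d, c + d]%classic) s * cos (2 * pi * t * s).
Proof. by rewrite ReM /= mul0r subr0 mulrA. Qed.

Lemma Im_window (c d t s : R) : ImC (window c d t s) =
  \1_(`[c - d, c + d]%classic) s * sin (2 * pi * t * s).
Proof. by rewrite ImM /= mul0r addr0 mulrA. Qed.

Lemma Re_cintegral1_window (c d t : R) : ReC (cintegral1 (window c d t)) =
  \int[leb]_s (\1_(`[c - d, c + d]%classic) s * cos (2 * pi * t * s)).
Proof. by apply: eq_Rintegral => s _; exact: Re_window. Qed.

Lemma Im_cintegral1_window (c d t : R) : ImC (cintegral1 (window c d t)) =
  \int[leb]_s (\1_(`[c - d, c + d]%classic) s * sin (2 * pi * t * s)).
Proof. by apply: eq_Rintegral => s _; exact: Im_window. Qed.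

Lemma integrable_indic_mul (a b : R) (u : measurableTypeR R -> R) :
  measurable_fun setT u -> (forall s, `|u s| <= 1) ->
  leb.-integrable setT (EFin \o (fun s : measurableTypeR R => \1_(`[a, b]%classic) s * u s)).
Proof.
move=> mu u1; apply: (le_integrable measurableT _ _ (integrable_indic_itv a b true false)).
  by apply/measurable_EFinP; exact: measurable_funM.
by move=> s _ /=; rewrite lee_fin normrM ler_piMr.
Qed.

Lemma cos_norm_le1 (x : R) : `|cos x| <= 1.
Proof. by rewrite ler_norml cos_geN1 cos_le1. Qed.

Lemma sin_norm_le1 (x : R) : `|sin x| <= 1.
Proof. by rewrite ler_norml sin_geN1 sin_le1. Qed.

Lemma measurable_cosZ (k : R) : measurable_fun setT (fun s : measurableTypeR R => cos (k * s)).
Proof. by apply: measurableT_comp; [exact: measurable_cos|exact: measurable_funM]. Qed.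

Lemma measurable_sinZ (k : R) : measurable_fun setT (fun s : measurableTypeR R => sin (k * s)).
Proof. by apply: measurableT_comp; [exact: measurable_sin|exact: measurable_funM]. Qed.

Lemma cintegrable1_window (c d t : R) : cintegrable1 (window c d t).
Proof.
split.
  under [X in integrable _ _ (_ \o X)]eq_fun do rewrite Re_window.
  apply: integrable_indic_mul; [exact: measurable_cosZ|move=> s; exact: cos_norm_le1].
under [X in integrable _ _ (_ \o X)]eq_fun do rewrite Im_window.
apply: integrable_indic_mul; [exact: measurable_sinZ|move=> s; exact: sin_norm_le1].
Qed.

Lemma Rintegral_indic_mul (a b : R) (u : R -> R) :
  \int[leb]_s (\1_(`[a, b]%classic) s * u s) = \int[leb]_(s in `[a, b]) u s.
Proof.
rewrite [RHS]Rintegral_mkcond; congr Rintegral; apply/funext => s.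
by rewrite patchE indicE; case: (s \in _); rewrite ?mul1r ?mul0r.
Qed.

Lemma itv_integral_le (a b : R) (u : measurableTypeR R -> R) : a <= b ->
  measurable_fun setT u -> (forall s, `|u s| <= 1) ->
  `|\int[leb]_s (\1_(`[a, b]%classic) s * u s)| <= b - a.
Proof.
move=> ab mu u1; have iu := integrable_indic_mul a b u mu u1.
apply: le_trans (le_normr_Rintegral measurableT iu) _.
have -> : b - a = \int[leb]_s (\1_(`[a, b]%classic) s).
  rewrite /Rintegral integral_indic // setIT.
  have := lebesgue_measure_itv (`[a, b] : interval R).
  rewrite /= lte_fin => ->; move: ab; rewrite le_eqVlt => /predU1P[->|->] //.
  by rewrite ltxx subrr.
apply: le_Rintegral => //.
- exact: integrable_norm.
- exact: integrable_indic_itv.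
- by move=> s _; rewrite normrM [X in X * _]ger0_norm // ler_piMr.
Qed.

(** The integral is [F b - F a]; the lemma serves with [F] a sine or a negated cosine of [k * s]. *)
Lemma oscillatory_integral_le (a b : R) (F g : R -> R) : a < b ->
  (forall s, is_derive s (1 : R) F (g s)) -> continuous g -> (forall s, `|F s| <= 1) ->
  `|\int[leb]_(s in `[a, b]) g s| <= 2.
Proof.
move=> ab dF cg F1.
have cF (s : R) : {for s, continuous F}.
  apply: differentiable_continuous; apply/derivable1_diffP.
  by have [] := dF s.
rewrite /Rintegral (@continuous_FTC2 _ g F) //.
- rewrite -EFinB /= (le_trans (ler_normB _ _)) //.
  by have := F1 a; have := F1 b; lra.
- by apply: continuous_subspaceT.
- split.
  + by move=> s _; have [] := dF s.
  + by apply: cvg_at_right_filter; exact: cF.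
  + by apply: cvg_at_left_filter; exact: cF.
- by move=> s _; rewrite derive1E; have [] := dF s.
Qed.

Lemma is_derive_mulZ (k s : R) : is_derive s (1 : R) (fun s : R => k * s) k.
Proof.
have := @is_deriveZ _ _ _ id k s 1 1 (is_derive_id s 1).
by rewrite /GRing.scale /= mulr1.
Qed.

Lemma is_derive_sinZ (k s : R) : is_derive s (1 : R) (fun s => sin (k * s)) (k * cos (k * s)).
Proof.
have := @is_derive1_comp _ sin (fun s => k * s) s _ _ (is_derive_sin _) (is_derive_mulZ k s).
by rewrite mulrC.
Qed.

Lemma is_derive_NcosZ (k s : R) : is_derive s (1 : R) (fun s => - cos (k * s)) (k * sin (k * s)).
Proof.
have := @is_derive1_comp _ cos (fun s => k * s) s _ _ (is_derive_cos _) (is_derive_mulZ k s).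
move=> /(@is_deriveN _ _ _ _ _ _ _); by rewrite mulNr opprK mulrC.
Qed.

Lemma continuous_mulZ (k : R) : continuous (fun s : R => k * s).
Proof. exact: mulrl_continuous. Qed.

(** Keeping [k] as a factor, instead of dividing the bound by it, makes the derivative of
    [sin (k * s)] appear and covers [k = 0]. *)
Lemma oscillatory_cos (a b k : R) : a < b ->
  `|k * \int[leb]_s (\1_(`[a, b]%classic) s * cos (k * s))| <= 2.
Proof.
move=> ab; rewrite -RintegralZl //; last first.
  apply: integrable_indic_mul; [exact: measurable_cosZ|move=> s; exact: cos_norm_le1].
under eq_Rintegral do rewrite mulrCA.
rewrite Rintegral_indic_mul; apply: (oscillatory_integral_le _ _ (fun s => sin (k * s))) => //.
- exact: is_derive_sinZ.
- move=> s; apply: (continuous_comp _ (continuous_mulZ k _)).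
  apply: continuous_comp; [exact: continuous_mulZ|exact: continuous_cos].
- by move=> s; exact: sin_norm_le1.
Qed.

Lemma oscillatory_sin (a b k : R) : a < b ->
  `|k * \int[leb]_s (\1_(`[a, b]%classic) s * sin (k * s))| <= 2.
Proof.
move=> ab; rewrite -RintegralZl //; last first.
  apply: integrable_indic_mul; [exact: measurable_sinZ|move=> s; exact: sin_norm_le1].
under eq_Rintegral do rewrite mulrCA.
rewrite Rintegral_indic_mul; apply: (oscillatory_integral_le _ _ (fun s => - cos (k * s))) => //.
- exact: is_derive_NcosZ.
- move=> s; apply: (continuous_comp _ (continuous_mulZ k _)).
  apply: continuous_comp; [exact: continuous_mulZ|exact: continuous_sin].
- by move=> s; rewrite normrN; exact: cos_norm_le1.
Qed.

(** The length bound controls [I ^+ 2] and the oscillation bound controls [(t * I) ^+ 2], the two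
    terms of the product; since pi is at least 2, the second one is at most 1. *)
Lemma sqr_oneDsqr_le (d t I : R) : `|I| <= 2 * d -> `|2 * pi * t * I| <= 2 ->
  I ^+ 2 * oneDsqr t <= 4 * d ^+ 2 + 1.
Proof.
move=> I1 I2; have p2 := @pi_ge2 R.
have h1 : I ^+ 2 <= 4 * d ^+ 2.
  rewrite -real_normK ?num_real //.
  have -> : 4 * d ^+ 2 = (2 * d) ^+ 2 by ring.
  by rewrite ler_pXn2r ?nnegrE // (le_trans _ I1).
have h2 : (t * I) ^+ 2 <= 1.
  rewrite -real_normK ?num_real // expr_le1 //.
  move: I2; rewrite -mulrA normrM ger0_norm; last by rewrite mulr_ge0 // pi_ge0.
  have := normr_ge0 (t * I); nra.
rewrite /oneDsqr; have -> : I ^+ 2 * (1 + t ^+ 2) = I ^+ 2 + (t * I) ^+ 2 by ring.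
exact: lerD.
Qed.

Lemma normc_sqr (z : R[i]) : Normc.normc z ^+ 2 = ReC z ^+ 2 + ImC z ^+ 2.
Proof. by case: z => a b /=; rewrite sqr_sqrtr // addr_ge0 // sqr_ge0. Qed.

(** The factor 2 adds the same estimate for the real and the imaginary part. This decay in [t] is
    what makes [band] square integrable. *)
Lemma normc_window_le (c d t : R) : 0 < d ->
  Normc.normc (cintegral1 (window c d t)) ^+ 2 <= 2 * (4 * d ^+ 2 + 1) * (oneDsqr t)^-1.
Proof.
move=> d0; have ab : c - d < c + d by lra.
have E : 2 * d = (c + d) - (c - d) by ring.
rewrite ler_pdivlMr // normc_sqr Re_cintegral1_window Im_cintegral1_window.
have -> : 2 * (4 * d ^+ 2 + 1) = (4 * d ^+ 2 + 1) + (4 * d ^+ 2 + 1) by ring.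
rewrite mulrDl; apply: lerD; apply: sqr_oneDsqr_le.
- rewrite E; apply: itv_integral_le; [exact: ltW|exact: measurable_cosZ|].
  by move=> s; exact: cos_norm_le1.
- exact: oscillatory_cos.
- rewrite E; apply: itv_integral_le; [exact: ltW|exact: measurable_sinZ|].
  by move=> s; exact: sin_norm_le1.
- exact: oscillatory_sin.
Qed.

(** At low frequency the cosine stays above 1/2 on the whole interval, so the real part of the
    integral is at least [d]. *)
Lemma window_neq0 (c d : R) : 0 < d -> exists2 e : R, 0 < e &
  forall t, 0 <= t <= e -> cintegral1 (window c d t) != 0.
Proof.
move=> d0.
have [y /= y0 cosy] : exists2 y : R, 0 < y & forall x, `|x| < y -> 2^-1 <= cos x.
  have := @continuous_cos R 0; rewrite /continuous_at cos0.
  move=> /cvgrPdist_le /(_ 2^-1) /=; rewrite invr_gt0 => /(_ (ltr0Sn _ 1)).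
  move=> /nbhs_ballP[y /= y0 H]; exists y => // x xy.
  have /H : ball 0 y x by rewrite /ball /= sub0r normrN.
  by rewrite /= ler_norml => /andP[? ?]; lra.
(* [L] bounds 2 pi |s| on the interval; for [t] up to [y / (2 * L)] the phase is at most [y / 2],
   strictly inside the range of [cosy]. *)
pose L := 2 * pi * (`|c| + d).
have L0 : 0 < L by rewrite !mulr_gt0 ?pi_gt0 // ltr_wpDl.
exists (y / (2 * L)) => [|t /andP[t0 te]]; first by rewrite divr_gt0 // mulr_gt0.
have I0 : 0 < \int[leb]_s (\1_(`[c - d, c + d]%classic) s * cos (2 * pi * t * s)).
  apply: (@lt_le_trans _ _ (\int[leb]_s (\1_(`[c - d, c + d]%classic) s * 2^-1))).
    rewrite Rintegral_indic_mul Rintegral_cst //.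
    have := lebesgue_measure_itv (`[c - d, c + d] : interval R).
    have cd : c - d < c + d by lra.
    rewrite /= lte_fin cd => ->; rewrite -EFinB /=; lra.
  apply: le_Rintegral => //.
  - apply: (integrable_indic_mul _ _ (cst 2^-1)) => // s.
    by rewrite ger0_norm ?invf_le1 ?invr_ge0 // ler1n.
  - apply: integrable_indic_mul; [exact: measurable_cosZ|move=> s; exact: cos_norm_le1].
  - move=> s _; rewrite indicE; case: (boolP (s \in _)); last by rewrite !mul0r.
    rewrite inE /= in_itv /= => /andP[s1 s2]; rewrite !mul1r.
    apply: cosy; apply: (@le_lt_trans _ _ (y / 2)); last lra.
    have -> : y / 2 = y / (2 * L) * L by field; rewrite gt_eqF.
    have sL : `|s| <= `|c| + d.
      have := ler_norm c; have := ler_norm (- c); rewrite normrN ler_norml => ? ?.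
      by apply/andP; split; lra.
    rewrite -mulrA normrM ger0_norm; last by rewrite mulr_ge0 // pi_ge0.
    have -> : y / (2 * L) * L = 2 * pi * (y / (2 * L) * (`|c| + d)).
      by rewrite mulrCA -/L.
    rewrite normrM (ger0_norm t0) ler_wpM2l //.
      by rewrite mulr_ge0 // pi_ge0.
    by apply: ler_pM.
apply/eqP => /(congr1 ReC); rewrite Re_cintegral1_window => E.
by rewrite E ltxx in I0.
Qed.

End window.

(** * The L2 norm and null sets *)

Section square_integrable.
Context {R : realType} {n : nat}.
Local Open Scope complex_scope.
Local Notation mu := (lebesgue_vec R n).
Local Notation ReC := (@complex.Re R).
Local Notation ImC := (@complex.Im R).
Implicit Types f g : 'cV[R]_n -> R[i].

Lemma normcE (z : R[i]) : Normc.normc z = Num.sqrt (ReC z ^+ 2 + ImC z ^+ 2).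
Proof. by case: z. Qed.

Lemma normc_ge0 (z : R[i]) : 0 <= Normc.normc z.
Proof. by rewrite normcE sqrtr_ge0. Qed.

Lemma measurable_normc f :
  measurable_fun setT (ReC \o f) -> measurable_fun setT (ImC \o f) ->
  measurable_fun setT (fun x => Normc.normc (f x)).
Proof.
move=> m1 m2; under eq_fun do rewrite normcE.
apply: measurableT_comp.
  exact: continuous_measurable_fun (@sqrt_continuous R).
by apply: measurable_funD; exact: measurable_funX.
Qed.

Lemma L2norm_lty f :
  (\int[mu]_x (Normc.normc (f x) ^+ 2)%:E < +oo)%E -> (L2norm f < +oo)%E.
Proof.
move=> h; rewrite /L2norm unlock /=; apply: poweR_lty.
move: h; congr (_ < _)%E; apply: eq_integral => x _.
by rewrite /= ger0_norm ?normc_ge0 // powR_mulrn // normc_ge0.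
Qed.

Lemma L2norm_eq0 f :
  measurable_fun setT (ReC \o f) -> measurable_fun setT (ImC \o f) ->
  L2norm f = 0%E -> {ae mu, forall x, f x = 0}.
Proof.
move=> m1 m2 /Lnorm_eq0_eq0 h.
have : (fun x => (Normc.normc (f x))%:E) = \0 %[ae mu].
  by apply: h => //; apply/measurable_EFinP; exact: measurable_normc.
by apply: filterS => x /= /(_ I) [] /Normc.eq0_normc.
Qed.

(** Meant for [g] the image of [f] under the frame operator: if it vanishes almost everywhere,
    [U - Id] preserves the norm of [f]. *)
Lemma L2norm_sub_ae0 f g :
  measurable_fun setT (ReC \o f) -> measurable_fun setT (ImC \o f) ->
  measurable_fun setT (ReC \o g) -> measurable_fun setT (ImC \o g) ->
  {ae mu, forall x, g x = 0} ->
  L2norm (fun x => g x - f x) = L2norm f.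
Proof.
move=> f1 f2 g1 g2 g0; rewrite /L2norm unlock /=; congr (_ `^ _)%E.
have mp (h : 'cV[R]_n -> R[i]) :
    measurable_fun setT (ReC \o h) -> measurable_fun setT (ImC \o h) ->
    measurable_fun setT (fun x => (`|(Normc.normc (h x))%:E| `^ 2)%E).
  move=> m1 m2; apply: (measurableT_comp (measurable_poweR _)).
  by apply: measurableT_comp => //; apply/measurable_EFinP; exact: measurable_normc.
apply: ae_eq_integral => //.
- apply: (mp (fun x => g x - f x)).
    rewrite (_ : _ \o _ = (ReC \o g) \- (ReC \o f)); first exact: measurable_funB.
    by apply/funext => x /=; case: (g x) (f x) => [a b] [c d].
  rewrite (_ : _ \o _ = (ImC \o g) \- (ImC \o f)); first exact: measurable_funB.
  by apply/funext => x /=; case: (g x) (f x) => [a b] [c d].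
- exact: mp.
- by apply: filterS g0 => x /= -> _; rewrite sub0r normcN.
Qed.

Lemma L2norm_opp f : L2norm (fun x => - f x) = L2norm f.
Proof. by apply: eq_Lnorm => x; rewrite normcN. Qed.

Lemma L2norm0 : L2norm (fun _ : 'cV[R]_n => 0 : R[i]) = 0%E.
Proof.
rewrite /L2norm (_ : (fun _ => _) = cst 0%E) ?Lnorm0 //.
by apply/funext => x; rewrite Normc.normc0.
Qed.

End square_integrable.

(** * A band-limited function *)

Section band_limited.
Context {R : realType} {n : nat}.
Local Open Scope complex_scope.
Local Notation mu := (lebesgue_vec R n).
Local Notation ReC := (@complex.Re R).
Local Notation ImC := (@complex.Im R).
Variables (c : 'cV[R]_n) (d : R).
Hypothesis d0 : 0 < d.

Definition cube : set 'cV[R]_n := box (fun i => c i 0 - d) (fun i => c i 0 + d).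

Lemma measurable_cube : measurable cube.
Proof. exact: measurable_box. Qed.

Definition cube_char (x xi : 'cV[R]_n) : R[i] :=
  (\1_cube xi)%:C * cexpi (2 * pi * dotv x xi).

(* the inverse Fourier transform of the indicator of the cube *)
Definition band (x : 'cV[R]_n) : R[i] := cintegral (cube_char x).

Lemma indic_cube xi : \1_cube xi = \prod_i \1_(`[c i 0 - d, c i 0 + d]%classic) (xi i 0) :> R.
Proof.
rewrite indicE; have [xiW|] := boolP (xi \in cube).
  rewrite big1 // => i _; rewrite indicE mem_set //= in_itv /=.
  by move: xiW; rewrite inE => /(_ i).
move=> /negP xiW; apply/esym/eqP/prodf_eq0.
have /existsNP[i Hi] : ~ (forall i, c i 0 - d <= xi i 0 <= c i 0 + d).
  by move=> H; apply: xiW; rewrite inE.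
by exists i => //; rewrite indicE memNset //= in_itv.
Qed.

Lemma cube_charE x : cube_char x = (fun xi => \prod_i window (c i 0) d (x i 0) (xi i 0)).
Proof.
apply/funext => xi; rewrite /cube_char indic_cube rmorph_prod /dotv mulr_sumr cexpi_sum.
by rewrite -big_split.
Qed.

Lemma bandE x : band x = \prod_i cintegral1 (window (c i 0) d (x i 0)).
Proof.
rewrite /band cube_charE.
by have [_ ->] := cintegral_prod _ (fun i => cintegrable1_window (c i 0) d (x i 0)).
Qed.

Lemma Re_cube_char x xi : ReC (cube_char x xi) = \1_cube xi * cos (2 * pi * dotv x xi).
Proof. by rewrite ReM /= mul0r subr0. Qed.

Lemma Im_cube_char x xi : ImC (cube_char x xi) = \1_cube xi * sin (2 * pi * dotv x xi).
Proof. by rewrite ImM /= mul0r addr0. Qed.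

Lemma measurable_dotv2 : measurable_fun setT
  (fun p : 'cV[R]_n * 'cV[R]_n => 2 * pi * dotv p.1 p.2).
Proof.
apply: measurable_funM => //; apply: measurable_dotv.
  exact: measurable_fst.
exact: measurable_snd.
Qed.

Lemma measurable_indic_cube : measurable_fun setT
  (fun p : 'cV[R]_n * 'cV[R]_n => \1_cube p.2 : R).
Proof.
apply: measurableT_comp; last exact: measurable_snd.
apply: measurable_indic; exact: measurable_cube.
Qed.

Lemma measurable_Re_cube_char : measurable_fun setT
  (fun p : 'cV[R]_n * 'cV[R]_n => ReC (cube_char p.1 p.2)).
Proof.
under eq_fun do rewrite Re_cube_char.
apply: measurable_funM; first exact: measurable_indic_cube.
exact: measurableT_comp measurable_cos measurable_dotv2.
Qed.

Lemma measurable_Im_cube_char : measurable_fun setT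
  (fun p : 'cV[R]_n * 'cV[R]_n => ImC (cube_char p.1 p.2)).
Proof.
under eq_fun do rewrite Im_cube_char.
apply: measurable_funM; first exact: measurable_indic_cube.
exact: measurableT_comp measurable_sin measurable_dotv2.
Qed.

Lemma measurable_Re_band : measurable_fun setT (ReC \o band).
Proof. exact: (measurable_Rintegral mu _ measurable_Re_cube_char). Qed.

Lemma measurable_Im_band : measurable_fun setT (ImC \o band).
Proof. exact: (measurable_Rintegral mu _ measurable_Im_cube_char). Qed.

Lemma normc_prod (I : Type) (r : seq I) (F : I -> R[i]) :
  Normc.normc (\prod_(i <- r) F i) = \prod_(i <- r) Normc.normc (F i).
Proof.
exact: (big_morph _ (@Normc.normcM R) (@Normc.normc1 R)).
Qed.

Lemma normc_band_le x :
  Normc.normc (band x) ^+ 2 <= (2 * (4 * d ^+ 2 + 1)) ^+ n * decay x.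
Proof.
rewrite bandE normc_prod -prodrXl /decay.
have -> : (2 * (4 * d ^+ 2 + 1)) ^+ n = \prod_(i < n) (2 * (4 * d ^+ 2 + 1)).
  by rewrite prodr_const card_ord.
rewrite -big_split /=; apply: ler_prod => i _; rewrite sqr_ge0 /=.
exact: normc_window_le.
Qed.

Lemma in_L2_band : in_L2 band.
Proof.
split; [exact: measurable_Re_band|exact: measurable_Im_band|].
apply: L2norm_lty.
have mB : measurable_fun setT (fun x => Normc.normc (band x) ^+ 2).
  apply: measurable_funX; apply: measurable_normc.
    exact: measurable_Re_band.
  exact: measurable_Im_band.
have iD := integrableZl measurableT ((2 * (4 * d ^+ 2 + 1)) ^+ n) (@integrable_decay R n).
have /integrableP[_] : mu.-integrable setT (EFin \o (fun x => Normc.normc (band x) ^+ 2)).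
  apply: le_integrable iD => //; first exact/measurable_EFinP.
  move=> x _ /=; rewrite lee_fin ger0_norm ?sqr_ge0 //.
  exact: le_trans (normc_band_le x) (ler_norm _).
congr (_ < _)%E; apply: eq_integral => x _ /=.
by rewrite ger0_norm // sqr_ge0.
Qed.

(** By [window_neq0] the product in [bandE] has no zero on the box with sides [[0, e i]], whose
    volume is positive, so [band] cannot vanish almost everywhere. *)
Lemma L2norm_band_neq0 : L2norm band != 0%E.
Proof.
apply/eqP => /(L2norm_eq0 _ measurable_Re_band measurable_Im_band) band0.
have /choice[e eP] (i : 'I_n) : exists e : R, 0 < e /\
    forall t, 0 <= t <= e -> cintegral1 (window (c i 0) d t) != 0.
  by have [e ? ?] := window_neq0 (c i 0) _ d0; exists e.
have : mu (box (fun=> 0) e) = 0%E.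
  apply/measure_negligible; first exact: measurable_box.
  apply: negligibleS band0 => x ex /=.
  rewrite bandE => /eqP; apply/negP/prodf_neq0 => i _.
  by have [_] := eP i; apply; exact: ex.
rewrite lebesgue_vec_box; last by move=> i; rewrite ltW //; case: (eP i).
case=> /eqP; apply/negP; rewrite gt_eqF // prodr_gt0 // => i _.
by rewrite subr0; case: (eP i).
Qed.

End band_limited.

(** * Orthogonality by exchange of integrals *)

Section pairing.
Context {R : realType} {n : nat}.
Local Open Scope complex_scope.
Local Notation mu := (lebesgue_vec R n).
Local Notation ReC := (@complex.Re R).
Local Notation ImC := (@complex.Im R).
Variables (c : 'cV[R]_n) (d : R).
Local Notation W := (cube c d).

(** The kernel is dominated by [H x * \1_W xi], integrable on the product because a cube has finite
    measure; after the exchange the inner integral vanishes at every [xi] of [W]. *)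
Lemma cube_fubini0 (k : 'cV[R]_n * 'cV[R]_n -> R) (H : 'cV[R]_n -> R) :
  measurable_fun setT k -> mu.-integrable setT (EFin \o H) ->
  (forall x xi, `|k (x, xi)| <= H x) ->
  (forall xi, W xi -> \int[mu]_x k (x, xi) = 0) ->
  \int[mu]_x \int[mu]_xi (\1_W xi * k (x, xi)) = 0.
Proof.
move=> mk iH kH k0.
have mH : measurable_fun setT H by have /measurable_EFinP := measurable_int _ iH.
have mW : measurable_fun setT (fun xi : 'cV[R]_n => \1_W xi : R).
  apply: measurable_indic; exact: measurable_cube.
have H0 x : 0 <= H x by exact: le_trans (kH x 0).
pose K (p : 'cV[R]_n * 'cV[R]_n) := (\1_W p.2 * k p)%:E.
have mK : measurable_fun setT K.
  apply/measurable_EFinP; apply: measurable_funM => //.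
  exact: measurableT_comp mW measurable_snd.
have mKx x : measurable_fun setT (fun xi => K (x, xi)).
  exact: measurableT_comp mK (measurable_pair1 x).
have iW : (\int[mu]_xi (\1_W xi)%:E < +oo)%E.
  rewrite integral_indic ?setIT //; [exact: lebesgue_box_lty|exact: measurable_cube].
have Kle x : (\int[mu]_xi `|K (x, xi)| <= (H x)%:E * \int[mu]_xi (\1_W xi)%:E)%E.
  rewrite -ge0_integralZl //; last 2 first.
  - exact/measurable_EFinP.
  - by rewrite lee_fin.
  apply: ge0_le_integral => //.
  - by apply: measurableT_comp.
  - by apply/measurable_EFinP; exact: measurable_funM.
  - move=> xi _; rewrite lee_fin normrM [X in X * _]ger0_norm // mulrC.
    by rewrite ler_wpM2r.
have iK1 x : mu.-integrable setT (fun xi => K (x, xi)).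
  apply/integrableP; split; first exact: mKx.
  apply: le_lt_trans (Kle x) _.
  by rewrite lte_mul_pinfty // ?lee_fin.
have iK : (mu \x mu)%E.-integrable setT K.
  apply/integrable12ltyP => //.
  apply: (@le_lt_trans _ _ (\int[mu]_x ((H x)%:E * \int[mu]_xi (\1_W xi)%:E))%E).
    apply: ge0_le_integral => //.
    - by move=> x _; exact: integral_ge0.
    - apply: (measurable_fun_fubini_tonelli_F (abse \o K)) => //=.
      exact: measurableT_comp.
    - apply: emeasurable_funM => //; exact/measurable_EFinP.
  rewrite ge0_integralZr //; last 3 first.
  - exact/measurable_EFinP.
  - by move=> x _; rewrite lee_fin.
  - exact: integral_ge0.
  apply: lte_mul_pinfty => //.
    by apply: integral_ge0 => x _; rewrite lee_fin.
  exact: integrable_fin_num.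
rewrite /Rintegral.
(* Fubini speaks of extended integrals: the inner one is finite by [iK1], so its [fine] can be
   undone. *)
rewrite (eq_integral (fun x => \int[mu]_xi K (x, xi))%E); last first.
  by move=> x _; rewrite fineK //; exact: (integrable_fin_num measurableT (iK1 x)).
rewrite (Fubini iK) integral0_eq // => xi _; rewrite /K /=.
have [/set_mem xiW|xiW] := boolP (xi \in W); last first.
  rewrite integral0_eq // => x _.
  by rewrite indicE (negbTE xiW) mul0r.
have ik : mu.-integrable setT (fun x => (k (x, xi))%:E).
  apply: le_integrable iH => //.
    by apply/measurable_EFinP; exact: measurableT_comp mk (measurable_pair2 xi).
  by move=> x _; rewrite lee_fin (le_trans (kH x xi)) // ler_norm.
under eq_integral do rewrite indicE mem_set // mul1r.
by rewrite -[LHS]fineK ?integrable_fin_num //; congr EFin; exact: k0.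
Qed.

(** Exchanging integrals turns the inner product into the integral over [W] of the conjugate of
    [fourier phi]. *)
Lemma cinner_band (phi : 'cV[R]_n -> R[i]) : cintegrable phi ->
  (forall xi, W xi -> fourier phi xi = 0) -> cinner (band c d) phi = 0.
Proof.
move=> [i1 i2] phi0.
have m1 : measurable_fun setT (ReC \o phi) by have /measurable_EFinP := measurable_int _ i1.
have m2 : measurable_fun setT (ImC \o phi) by have /measurable_EFinP := measurable_int _ i2.
have m1' : measurable_fun setT (fun p : 'cV[R]_n * 'cV[R]_n => ReC (phi p.1)).
  exact: measurableT_comp m1 measurable_fst.
have m2' : measurable_fun setT (fun p : 'cV[R]_n * 'cV[R]_n => ImC (phi p.1)).
  exact: measurableT_comp m2 measurable_fst.
have mcos : measurable_fun setT (fun p : 'cV[R]_n * 'cV[R]_n => cos (2 * pi * dotv p.1 p.2)).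
  exact: measurableT_comp measurable_cos measurable_dotv2.
have msin : measurable_fun setT (fun p : 'cV[R]_n * 'cV[R]_n => sin (2 * pi * dotv p.1 p.2)).
  exact: measurableT_comp measurable_sin measurable_dotv2.
(* [k1] and [k2] are the real and imaginary parts of the conjugate of [phi x] times exp(2 pi i x .
   xi). Integrated in [x] they give the real part and minus the imaginary part of
   [fourier phi xi]. *)
pose k1 (p : 'cV[R]_n * 'cV[R]_n) :=
  ReC (phi p.1) * cos (2 * pi * dotv p.1 p.2) + ImC (phi p.1) * sin (2 * pi * dotv p.1 p.2).
pose k2 (p : 'cV[R]_n * 'cV[R]_n) :=
  ReC (phi p.1) * sin (2 * pi * dotv p.1 p.2) - ImC (phi p.1) * cos (2 * pi * dotv p.1 p.2).
have mk1 : measurable_fun setT k1 by apply: measurable_funD; exact: measurable_funM.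
have mk2 : measurable_fun setT k2 by apply: measurable_funB; exact: measurable_funM.
pose H x := `|ReC (phi x)| + `|ImC (phi x)|.
have iH : mu.-integrable setT (EFin \o H).
  have := integrableD measurableT (integrable_norm i1) (integrable_norm i2).
  by congr (integrable _ _ _); apply/funext.
have kH1 x xi : `|k1 (x, xi)| <= H x.
  rewrite (le_trans (ler_normD _ _)) // lerD // normrM ler_piMr //.
    exact: cos_norm_le1.
  exact: sin_norm_le1.
have kH2 x xi : `|k2 (x, xi)| <= H x.
  rewrite (le_trans (ler_normB _ _)) // lerD // normrM ler_piMr //.
    exact: sin_norm_le1.
  exact: cos_norm_le1.
have k10 xi : W xi -> \int[mu]_x k1 (x, xi) = 0.
  move=> /phi0 /(congr1 ReC) /= <-; apply: eq_Rintegral => x _.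
  by rewrite ReM /= cosN sinN mulrN opprK.
have k20 xi : W xi -> \int[mu]_x k2 (x, xi) = 0.
  move=> /phi0 /(congr1 ImC) /= h.
  have ik2 : mu.-integrable setT (EFin \o (fun x => k2 (x, xi))).
    apply: le_integrable iH => //.
      by apply/measurable_EFinP; exact: measurableT_comp mk2 (measurable_pair2 xi).
    by move=> x _; rewrite lee_fin (le_trans (kH2 x xi)) // ler_norm.
  apply: oppr_inj; rewrite oppr0 -[RHS]h -mulN1r -RintegralZl //.
  apply: eq_Rintegral => x _.
  by rewrite ImM /= cosN sinN /k2 /=; ring.
have ch x : cintegrable (cube_char c d x).
  rewrite cube_charE.
  exact: (cintegral_prod _ (fun i => cintegrable1_window (c i 0) d (x i 0))).1.
have icos x : mu.-integrable setT (EFin \o (fun xi => \1_W xi * cos (2 * pi * dotv x xi))).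
  have [+ _] := ch x; congr (integrable _ _ _).
  by apply/funext => xi; congr (_%:E); exact: Re_cube_char.
have isin x : mu.-integrable setT (EFin \o (fun xi => \1_W xi * sin (2 * pi * dotv x xi))).
  have [_] := ch x; congr (integrable _ _ _).
  by apply/funext => xi; congr (_%:E); exact: Im_cube_char.
have ReB x : ReC (band c d x) = \int[mu]_xi (\1_W xi * cos (2 * pi * dotv x xi)).
  by apply: eq_Rintegral => xi _; exact: Re_cube_char.
have ImB x : ImC (band c d x) = \int[mu]_xi (\1_W xi * sin (2 * pi * dotv x xi)).
  by apply: eq_Rintegral => xi _; exact: Im_cube_char.
have Z := @integrable_scale R n.
rewrite /cinner /cintegral -[RHS]/(0 +i* 0); congr (_ +i* _).
  rewrite -(cube_fubini0 k1 H mk1 iH kH1 k10); apply: eq_Rintegral => x _.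
  transitivity (ReC (phi x) * ReC (band c d x) + ImC (phi x) * ImC (band c d x)).
    by case: (phi x) (band c d x) => [a b] [a' b'] /=; ring.
  rewrite ReB ImB -!RintegralZl // -RintegralD //; try exact: Z.
  by apply: eq_Rintegral => xi _; rewrite /k1 /=; ring.
rewrite -(cube_fubini0 k2 H mk2 iH kH2 k20); apply: eq_Rintegral => x _.
transitivity (ReC (phi x) * ImC (band c d x) - ImC (phi x) * ReC (band c d x)).
  by case: (phi x) (band c d x) => [a b] [a' b'] /=; ring.
rewrite ReB ImB -!RintegralZl // -RintegralB //; try exact: Z.
by apply: eq_Rintegral => xi _; rewrite /k2 /=; ring.
Qed.

End pairing.

(** * Fourier transform and affine maps *)

Section fourier_affine.
Context {R : realType} {n : nat}.
Local Open Scope complex_scope.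
Local Notation mu := (lebesgue_vec R n).
Local Notation ReC := (@complex.Re R).
Local Notation ImC := (@complex.Im R).

Lemma dotvE (x y : 'cV[R]_n) : dotv x y = (x^T *m y) 0 0.
Proof. by rewrite mxE; apply: eq_bigr => i _; rewrite mxE. Qed.

Lemma dotv_mulmxl (M : 'M[R]_n) (x y : 'cV[R]_n) :
  dotv (M *m x) y = dotv x (M^T *m y).
Proof. by rewrite !dotvE trmx_mul mulmxA. Qed.

Lemma dotvBl (x y z : 'cV[R]_n) : dotv (x - y) z = dotv x z - dotv y z.
Proof. by rewrite !dotvE linearB /= mulmxBl !mxE. Qed.

Lemma measurable_cexpi_dotv (eta : 'cV[R]_n) :
  measurable_fun setT (fun x : 'cV[R]_n => - (2 * pi * dotv x eta)).
Proof.
apply: measurableT_comp => //; apply: measurable_funM => //.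
exact: measurable_dotv.
Qed.

Lemma cintegrable_fourier (psi : 'cV[R]_n -> R[i]) (eta : 'cV[R]_n) :
  cintegrable psi -> cintegrable (fun x => psi x * cexpi (- (2 * pi * dotv x eta))).
Proof.
move=> [i1 i2].
have m1 : measurable_fun setT (ReC \o psi) by have /measurable_EFinP := measurable_int _ i1.
have m2 : measurable_fun setT (ImC \o psi) by have /measurable_EFinP := measurable_int _ i2.
have mc := measurableT_comp measurable_cos (measurable_cexpi_dotv eta).
have ms := measurableT_comp measurable_sin (measurable_cexpi_dotv eta).
have iH := integrableD measurableT (integrable_norm i1) (integrable_norm i2).
split; apply: le_integrable iH => //.
- under [X in _ \o X]eq_fun do rewrite ReM /=.
  by apply/measurable_EFinP; apply: measurable_funB; apply: measurable_funM.
- move=> x _ /=; rewrite ReM lee_fin [leRHS]ger0_norm ?addr_ge0 //.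
  rewrite (le_trans (ler_normB _ _)) // lerD // normrM ler_piMr //.
    exact: cos_norm_le1.
  exact: sin_norm_le1.
- under [X in _ \o X]eq_fun do rewrite ImM /=.
  by apply/measurable_EFinP; apply: measurable_funD; apply: measurable_funM.
- move=> x _ /=; rewrite ImM lee_fin [leRHS]ger0_norm ?addr_ge0 //.
  rewrite (le_trans (ler_normD _ _)) // lerD // normrM ler_piMr //.
    exact: sin_norm_le1.
  exact: cos_norm_le1.
Qed.

Lemma cintegral_affine (M : 'M[R]_n) (k : 'cV[R]_n) : M \in unitmx ->
  exists c : R, forall h : 'cV[R]_n -> R[i], cintegrable h ->
    cintegrable (fun x => h (M *m x - k)) /\
    cintegral (fun x => h (M *m x - k)) = c%:C * cintegral h.
Proof.
move=> uM; have [c cE] := integral_affine M k uM; exists c => h [h1 h2].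
have [? E1] := cE _ h1; have [? E2] := cE _ h2; split; first by split.
by rewrite /cintegral E1 E2; simpc.
Qed.

(** The full formula multiplies [fourier psi] at the transformed frequency by [a], a phase and the
    existential constant of [cintegral_affine]; vanishing is the consequence that does not depend on
    that constant. *)
Lemma fourier_affine_eq0 (M : 'M[R]_n) (k : 'cV[R]_n) (a : R[i])
    (psi : 'cV[R]_n -> R[i]) (xi : 'cV[R]_n) : M \in unitmx -> cintegrable psi ->
  fourier psi ((invmx M)^T *m xi) = 0 ->
  fourier (fun x => a * psi (M *m x - k)) xi = 0.
Proof.
move=> uM ipsi; set eta := _ *m xi => psi0.
have [c cE] := cintegral_affine M k uM.
have [ih hE] := cE _ (cintegrable_fourier psi eta ipsi).
pose z := a * cexpi (- (2 * pi * dotv k eta)).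
transitivity (cintegral (fun x => z * (psi (M *m x - k) *
    cexpi (- (2 * pi * dotv (M *m x - k) eta))))); last first.
  by rewrite cintegralZ // hE -/(fourier psi eta) psi0 !mulr0.
rewrite /fourier; congr cintegral; apply/funext => x.
(* [M^T *m eta = xi] by the choice of [eta], so the phase splits into one in the new variable and
   one constant in [x]. *)
have -> : dotv x xi = dotv (M *m x - k) eta + dotv k eta.
  rewrite dotvBl subrK dotv_mulmxl /eta mulmxA -trmx_mul mulVmx //.
  by rewrite trmx1 mul1mx.
rewrite mulrDr opprD cexpiD /z.
set e1 := cexpi _; set e2 := cexpi _; set u := psi _.
by rewrite [e1 * e2]mulrC !mulrA; congr (_ * _); rewrite -!mulrA; congr (_ * _); rewrite mulrC.
Qed.

End fourier_affine.

(** * Euclidean norm and matrices *)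

Section euclidean_norm.
Context {R : realType} {n : nat}.
Implicit Types (x y : 'cV[R]_n) (M : 'M[R]_n).

Lemma dotvC x y : dotv x y = dotv y x.
Proof. by apply: eq_bigr => i _; rewrite mulrC. Qed.

Lemma dotvDl x y z : dotv (x + y) z = dotv x z + dotv y z.
Proof. by rewrite !dotvE linearD /= mulmxDl !mxE. Qed.

Lemma dotvZl a x y : dotv (a *: x) y = a * dotv x y.
Proof. by rewrite mulr_sumr; apply: eq_bigr => i _; rewrite mxE mulrA. Qed.

Lemma dotv_ge0 x : 0 <= dotv x x.
Proof. by apply: sumr_ge0 => i _; rewrite -expr2 sqr_ge0. Qed.

Lemma enorm_ge0 x : 0 <= enorm x.
Proof. exact: sqrtr_ge0. Qed.

Lemma enorm_sqr x : enorm x ^+ 2 = dotv x x.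
Proof. by rewrite sqr_sqrtr // dotv_ge0. Qed.

Lemma enormZ a x : enorm (a *: x) = `|a| * enorm x.
Proof.
rewrite /enorm dotvZl dotvC dotvZl mulrA -expr2 sqrtrM ?sqr_ge0 //.
by rewrite sqrtr_sqr.
Qed.

Lemma enorm0_eq0 x : enorm x = 0 -> x = 0.
Proof.
move=> /(congr1 (fun r => r ^+ 2)); rewrite enorm_sqr expr0n /= => /eqP.
rewrite psumr_eq0; last by move=> i _; rewrite -expr2 sqr_ge0.
move=> /allP h; apply/colP => i; rewrite mxE; apply/eqP.
by rewrite -sqrf_eq0 expr2; apply: h; rewrite mem_index_enum.
Qed.

Lemma dotv_le x y : dotv x y <= enorm x * enorm y.
Proof.
have [y0|ny0] := eqVneq (enorm y) 0.
  rewrite y0 mulr0 (enorm0_eq0 _ y0) /dotv big1 // => i _.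
  by rewrite mxE mulr0.
have py : 0 < enorm y by rewrite lt_neqAle eq_sym ny0 enorm_ge0.
(* With a, b the two norms and p the inner product, this square expands to 2 a b (a b - p), and a b
   can be cancelled once both norms are positive. *)
have := dotv_ge0 (enorm y *: x + (- enorm x) *: y).
rewrite dotvDl !dotvZl ![dotv _ (_ + _)]dotvC !dotvDl !dotvZl [dotv y x]dotvC.
rewrite -!enorm_sqr.
have [x0|nx0] := eqVneq (enorm x) 0.
  move=> _; rewrite x0 mul0r (enorm0_eq0 _ x0) /dotv big1 // => i _.
  by rewrite mxE mul0r.
have px : 0 < enorm x by rewrite lt_neqAle eq_sym nx0 enorm_ge0.
have pxy := mulr_gt0 px py.
set a := enorm x in px pxy *; set b := enorm y in py pxy *; set p := dotv x y.
move=> h; rewrite -subr_ge0 -(pmulr_rge0 _ pxy); nra.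
Qed.

Lemma enormD x y : enorm (x + y) <= enorm x + enorm y.
Proof.
rewrite -(@ler_pXn2r _ 2) ?nnegrE ?addr_ge0 ?enorm_ge0 // enorm_sqr.
rewrite dotvDl ![dotv _ (_ + _)]dotvC !dotvDl [dotv y x]dotvC -!enorm_sqr.
have := dotv_le x y; nra.
Qed.

Lemma enorm_sub x y : enorm x - enorm y <= enorm (x + y).
Proof.
rewrite lerBlDr; have := enormD (x + y) (- y); rewrite addrK.
by rewrite -scaleN1r enormZ normrN1 mul1r.
Qed.

Lemma enorm_le_sum x : enorm x <= \sum_i `|x i 0|.
Proof.
rewrite -(@ler_pXn2r _ 2) ?nnegrE ?enorm_ge0 ?sumr_ge0 // enorm_sqr expr2 mulr_suml.
apply: ler_sum => i _; rewrite (le_trans (ler_norm _)) // normrM ler_wpM2l //.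
by rewrite (bigD1 i) //= lerDl sumr_ge0.
Qed.

Lemma coord_le_enorm x i : `|x i 0| <= enorm x.
Proof.
rewrite -(@ler_pXn2r _ 2) ?nnegrE ?enorm_ge0 // enorm_sqr real_normK ?num_real //.
rewrite /dotv (bigD1 i) //= -expr2 lerDl sumr_ge0 // => j _.
by rewrite -expr2 sqr_ge0.
Qed.

Lemma enorm_mulmx_bounded M : exists2 K : R, 1 <= K &
  forall x, enorm (M *m x) <= K * enorm x.
Proof.
(* The added 1 makes [K] at least 1, so that its powers increase with the exponent. *)
exists (1 + \sum_i \sum_j `|M i j|) => [|x].
  by rewrite lerDl sumr_ge0 // => i _; rewrite sumr_ge0.
rewrite (le_trans (enorm_le_sum _)) // mulrDl mul1r ler_wpDl ?enorm_ge0 //.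
rewrite mulr_suml; apply: ler_sum => i _; rewrite mxE mulr_suml.
rewrite (le_trans (ler_norm_sum _ _ _)) //; apply: ler_sum => j _.
by rewrite normrM ler_wpM2l // coord_le_enorm.
Qed.

(** The square of [enorm (M^T *m x)] equals [dotv x (M *m (M^T *m x))], at most k |x| |M^T x| by
    Cauchy-Schwarz; one factor then cancels. *)
Lemma enorm_trmx_le M (k : R) : 0 <= k -> (forall x, enorm (M *m x) <= k * enorm x) ->
  forall x, enorm (M^T *m x) <= k * enorm x.
Proof.
move=> k0 Mk x; have [->|nz] := eqVneq (enorm (M^T *m x)) 0.
  by rewrite mulr_ge0 // enorm_ge0.
have pz : 0 < enorm (M^T *m x) by rewrite lt_neqAle eq_sym nz enorm_ge0.
rewrite -(ler_pM2l pz) -expr2 enorm_sqr dotv_mulmxl trmxK.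
rewrite (le_trans (dotv_le _ _)) // mulrC.
have := Mk (M^T *m x); have := enorm_ge0 x; nra.
Qed.

End euclidean_norm.

(** * Iterates of an expansive matrix *)

Section expansive_geometry.
Context {R : realType} {n : nat}.
Local Notation V := 'cV[R]_n.+1.

(** A singular matrix has the eigenvalue 0, whose modulus is below 1. *)
Lemma expansive_unitmx (A : 'M[R]_n.+1) : expansive A -> A \in unitmx.
Proof.
move=> eA; rewrite unitmxE unitfE; apply/eqP => detA0.
have /eqP/det0P[v v0 vA] : \det (map_mx (real_complex R) A) = 0.
  by rewrite det_map_mx detA0 rmorph0.
have : complex_eigenvalue A 0.
  by apply/eigenvalueP; exists v => //; rewrite vA scale0r.
by move/eA; rewrite Normc.normc0 ltNge ler01.
Qed.

(* [t Delta] included in [A Delta] says that [A^-1] is a contraction by [1 / t]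
   for the norm whose unit ball is [Delta = P B]. *)
Lemma ellipsoid_contraction (A : 'M[R]_n.+1) (Delta : set V) : A \in unitmx ->
  expansive_ellipsoid A Delta -> exists (P : 'M[R]_n.+1) (k : R),
    [/\ P \in unitmx, 0 < k < 1 &
    forall x, enorm (invmx P *m invmx A *m P *m x) <= k * enorm x].
Proof.
move=> uA [[P uP DE] _ [t [t1 _ tA]]].
have t0 : 0 < t by exact: lt_trans t1.
exists P, t^-1; split => //; first by rewrite invr_gt0 t0 invf_lt1.
set N := _ *m P => x.
have unit_ball (y : V) : enorm y < 1 -> enorm (N *m y) <= t^-1.
  move=> y1.
  have /tA[u] : [set t *: x | x in Delta] (t *: (P *m y)).
    by exists (P *m y) => //; rewrite DE; exists y.
  rewrite DE => -[z z1 <-] E.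
  have -> : N *m y = t^-1 *: z.
    rewrite /N -!mulmxA; apply: (canRL (scalerK _)); first by rewrite gt_eqF.
    rewrite 2!scalemxAr -E.
    by rewrite (mulmxA (invmx A)) mulVmx // mul1mx mulmxA mulVmx // mul1mx.
  rewrite enormZ ger0_norm ?invr_ge0 ?(ltW t0) //.
  by rewrite ler_piMr ?invr_ge0 ?(ltW t0) ?(ltW z1).
apply/ler_addgt0Pr => e e0.
(* [Delta] is the image of the open unit ball, so [x] must be scaled strictly inside; the excess
   [t * e] becomes exactly [e] after multiplication by [t^-1]. *)
pose s := enorm x + t * e.
have s0 : 0 < s by rewrite ltr_wpDl ?enorm_ge0 // mulr_gt0.
have : enorm (s^-1 *: x) < 1.
  rewrite enormZ ger0_norm ?invr_ge0 ?ltW // mulrC ltr_pdivrMr // mul1r.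
  by rewrite ltrDl mulr_gt0.
move=> /unit_ball; rewrite -scalemxAr enormZ ger0_norm ?invr_ge0 ?(ltW s0) //.
rewrite mulrC ler_pdivrMr // /s mulrDr mulrA mulVf ?gt_eqF // mul1r.
by [].
Qed.

Lemma trmx_expr (A : 'M[R]_n.+1) m : (A ^+ m)^T = A^T ^+ m.
Proof.
elim: m => [|m IH]; first by rewrite !expr0 trmx1.
by rewrite exprS exprSr -IH; exact: trmx_mul.
Qed.

Lemma iter_contraction (N : 'M[R]_n.+1) (k : R) m : 0 <= k ->
  (forall x : V, enorm (N *m x) <= k * enorm x) ->
  forall x : V, enorm (N ^+ m *m x) <= k ^+ m * enorm x.
Proof.
move=> k0 Nk; elim: m => [|m IH] x; first by rewrite !expr0 mul1mx mul1r.
rewrite !exprS -[X in enorm X]mulmxA (le_trans (Nk _)) // -mulrA.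
by rewrite ler_wpM2l.
Qed.

(** Conjugated by [P^T], the adjoint inverse becomes the transpose of the contraction, which
    contracts at the same rate. The conjugating matrices telescope in powers, so their norms enter
    once, as [C], whatever [m] is. *)
Lemma adjoint_inverse_iterates (A : 'M[R]_n.+1) (Delta : set V) : A \in unitmx ->
  expansive_ellipsoid A Delta -> exists C k : R, [/\ 0 < C, 0 < k < 1 &
    forall m (x : V), enorm (invmx A^T ^+ m *m x) <= C * k ^+ m * enorm x].
Proof.
move=> uA eD; have [P [k [uP k01 hk]]] := ellipsoid_contraction A Delta uA eD.
have /andP[k0 k1] := k01.
have hkT := enorm_trmx_le _ _ (ltW k0) hk.
have [K1 K1ge1 hK1] := enorm_mulmx_bounded P^T.
have [K2 K2ge1 hK2] := enorm_mulmx_bounded (invmx P^T).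
exists (K2 * K1), k; split => //; first by rewrite mulr_gt0 ?(lt_le_trans ltr01).
have uPT : P^T \in unitmx by rewrite unitmx_tr.
set N := (_ *m P)^T in hkT.
have NE : N = P^T *m invmx A^T *m invmx P^T.
  by rewrite /N !trmx_mul !trmx_inv mulmxA.
move=> m x.
have conj : invmx A^T ^+ m *m x = invmx P^T *m (N ^+ m *m (P^T *m x)).
  elim: m => [|m IH].
    by rewrite !expr0 !mul1mx mulmxA mulVmx // mul1mx.
  rewrite !exprS -[LHS]mulmxA IH -[X in _ = _ *m X]mulmxA.
  by set u := N ^+ m *m _; rewrite NE !mulmxA mulVmx // mul1mx.
rewrite conj (le_trans (hK2 _)) // -!mulrA ler_wpM2l //; first exact: le_trans ler01 _.
rewrite (le_trans (iter_contraction _ _ m (ltW k0) hkT _)) //.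
by rewrite mulrCA ler_wpM2l // exprn_ge0 // ltW.
Qed.

Lemma eigen_iterates (B : 'M[R]_n.+1) (l : R) (v : V) m :
  B *m v = l *: v -> B ^+ m *m v = l ^+ m *: v.
Proof.
move=> Bv; elim: m => [|m IH]; first by rewrite !expr0 mul1mx scale1r.
by rewrite exprS -[LHS]mulmxA IH -scalemxAr Bv scalerA exprSr.
Qed.

Lemma exists_exp_small (k e : R) : 0 < k < 1 -> 0 < e -> exists m, k ^+ m <= e.
Proof.
move=> /andP[k0 k1] e0; have := @cvg_expr _ k; rewrite ger0_norm ?ltW // => /(_ k1).
move=> /cvgrPdist_le /(_ e e0)[m _ /(_ m (leqnn m))].
by rewrite sub0r normrN ger0_norm ?exprn_ge0 ?(ltW k0) // => ?; exists m.
Qed.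

(** For [w] of norm [rho] with r1 < rho < |l| r0, forward iterates of [A^T] keep the norm at least
    [rho] and inverse ones bring it to at most [rho / |l|], below [r0]. For a nearby [xi] the error
    stays bounded under inverse iterates. Under forward ones it is controlled up to an exponent
    [m0]; past it, an iterate of norm at most [r1] would, contracted back, make [xi] too short. *)
Lemma avoiding_cube (A : 'M[R]_n.+1) (Delta : set V) (l : R) (v : V) (r0 r1 : R) :
  A \in unitmx -> expansive_ellipsoid A Delta -> v != 0 -> A^T *m v = l *: v ->
  0 < r0 -> r0 < r1 -> r1 / r0 < `|l| ->
  exists (w : V) (d : R), 0 < d /\ forall xi, cube w d xi -> forall j : int,
    ~ (r0 <= enorm ((invmx (A ^ j))^T *m xi) <= r1).
Proof.
move=> uA eD v0 Av r00 r01 rl.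
have [C [k [C0 k01 hC]]] := adjoint_inverse_iterates A Delta uA eD.
have /andP[k0 k1] := k01.
have uAT : A^T \in unitmx by rewrite unitmx_tr.
have l1 : 1 < `|l| by rewrite (lt_trans _ rl) // ltr_pdivlMr // mul1r.
have l0 : l != 0 by rewrite -normr_eq0 gt_eqF // (lt_trans ltr01).
have lpos : 0 < `|l| by rewrite normr_gt0.
have r1l : r1 < `|l| * r0 by rewrite -ltr_pdivrMr.
pose rho := (r1 + `|l| * r0) / 2.
have rho1 : r1 < rho by rewrite /rho; lra.
have rho2 : rho / `|l| < r0 by rewrite ltr_pdivrMr // mulrC /rho; lra.
have rho0 : 0 < rho by lra.
have nv : 0 < enorm v.
  rewrite lt_neqAle enorm_ge0 andbT eq_sym; apply: contra v0 => /eqP h.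
  by apply/eqP; exact: enorm0_eq0.
pose w := (rho / enorm v) *: v.
have nw : enorm w = rho.
  by rewrite enormZ ger0_norm ?(ltW (divr_gt0 rho0 nv)) // divfK // gt_eqF.
have Bw : A^T *m w = l *: w by rewrite /w -scalemxAr Av !scalerA [l * _]mulrC.
have Gw : invmx A^T *m w = l^-1 *: w.
  by apply: (canRL (scalerK l0)); rewrite scalemxAr -Bw mulmxA mulVmx // mul1mx.
have [K K1 hK] := enorm_mulmx_bounded A^T.
have K0 : 0 <= K by exact: le_trans K1.
(* Chosen so that [C * k ^+ m0 * r1] is at most [rho / 4], below the lower bound [rho / 2] on
   [enorm xi]. *)
have [m0 hm0] : exists m0, k ^+ m0 <= rho / (4 * C * r1).
  by apply: exists_exp_small => //; rewrite divr_gt0 // !mulr_gt0 // (lt_trans r00).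
have KX0 : 0 < K ^+ m0 by rewrite exprn_gt0 // (lt_le_trans ltr01).
(* The bound [rho / 2] keeps [xi] away from 0; the other two keep the errors [C * eta] and
   [K ^+ m0 * eta] strictly inside the gaps below [r0] and above [r1]. *)
pose eta := Num.min (rho / 2) (Num.min ((r0 - rho / `|l|) / (2 * C)) ((rho - r1) / (2 * K ^+ m0))).
have eta0 : 0 < eta.
  rewrite /eta !lt_min; apply/and3P.
  by split; rewrite divr_gt0 ?subr_gt0 // mulr_gt0.
have eta1 : eta <= rho / 2 by rewrite /eta ge_min lexx.
have eta2 : C * eta < r0 - rho / `|l|.
  have : eta <= (r0 - rho / `|l|) / (2 * C) by rewrite /eta !ge_min lexx orbT.
  rewrite ler_pdivlMr ?mulr_gt0 // => h.
  have : 0 < r0 - rho / `|l| by rewrite subr_gt0.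
  by move: h; set u := r0 - _; nra.
have eta3 : K ^+ m0 * eta < rho - r1.
  have : eta <= (rho - r1) / (2 * K ^+ m0) by rewrite /eta !ge_min lexx !orbT.
  rewrite ler_pdivlMr ?mulr_gt0 // => h.
  have : 0 < rho - r1 by rewrite subr_gt0.
  by move: h; set u := rho - r1; nra.
(* Dividing by the dimension makes the sum of the coordinate deviations, hence [enorm (xi - w)], at
   most [eta]. *)
exists w, (eta / n.+1%:R); split=> [|xi xiW]; first by rewrite divr_gt0.
pose z := xi - w.
have xiE : xi = w + z by rewrite /z addrC subrK.
have nz : enorm z <= eta.
  rewrite (le_trans (enorm_le_sum _)) //.
  have -> : eta = \sum_(i < n.+1) eta / n.+1%:R.
    by rewrite sumr_const card_ord -[RHS]mulr_natr divfK.
  apply: ler_sum => i _; rewrite mxE [(- w) i 0]mxE ler_norml.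
  have := xiW i; move: (w i 0) (eta / _) => wi e /andP[? ?].
  by apply/andP; split; lra.
have nz0 := enorm_ge0 z.
have inner m : enorm (invmx A^T ^+ m.+1 *m xi) < r0.
  rewrite xiE mulmxDr (eigen_iterates _ _ _ _ Gw).
  apply: le_lt_trans (enormD _ _) _.
  have h1 : enorm (l^-1 ^+ m.+1 *: w) <= rho / `|l|.
    rewrite enormZ nw mulrC ler_wpM2l ?(ltW rho0) // normrX normfV exprS.
    by rewrite ger_pMr ?invr_gt0 // exprn_ile1 ?invr_ge0 ?invf_le1 ?ltW.
  have h2 : enorm (invmx A^T ^+ m.+1 *m z) <= C * eta.
    rewrite (le_trans (hC _ _)) // -mulrA ler_wpM2l ?(ltW C0) //.
    by rewrite (le_trans _ nz) // ler_piMl // exprn_ile1 ?(ltW k0) ?(ltW k1).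
  by apply: le_lt_trans (lerD h1 h2) _; rewrite -ltrBrDl.
have outer m : r1 < enorm (A^T ^+ m *m xi).
  have [mm0|m0m] := leqP m m0.
    rewrite xiE mulmxDr (eigen_iterates _ _ _ _ Bw).
    apply: lt_le_trans (enorm_sub _ _).
    have h1 : rho <= enorm (l ^+ m *: w).
      by rewrite enormZ nw normrX ler_peMl ?(ltW rho0) // exprn_ege1 // ltW.
    have h2 : enorm (A^T ^+ m *m z) <= K ^+ m0 * eta.
      rewrite (le_trans (iter_contraction _ _ m K0 hK _)) //.
      by rewrite ler_pM ?exprn_ge0 // ler_weXn2l.
    by apply: lt_le_trans (lerB h1 h2); rewrite ltrBrDr -ltrBrDl.
  (* A late iterate within radius [r1] would come from a vector of norm at most [rho / 4]. *)
  rewrite ltNge; apply/negP => h.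
  have nxi : rho / 2 <= enorm xi.
    rewrite xiE; apply: le_trans (enorm_sub _ _); rewrite nw.
    by move: (le_trans nz eta1); move: (enorm z) => u ?; lra.
  have := hC m (A^T ^+ m *m xi).
  have -> : invmx A^T ^+ m *m (A^T ^+ m *m xi) = xi.
    rewrite mulmxA; have -> : invmx A^T ^+ m *m A^T ^+ m = 1%:M.
      have GB : GRing.comm (invmx A^T) A^T.
        by rewrite /GRing.comm -[LHS]/(_ *m _) -[RHS]/(_ *m _) mulVmx // mulmxV.
      rewrite -[LHS]/(_ * _) -exprMn_comm // -[X in X ^+ m]/(_ *m _) mulVmx //.
      exact: expr1n.
    by rewrite mul1mx.
  have km : k ^+ m <= k ^+ m0 by rewrite ler_wiXn2l ?(ltW k0) ?(ltW k1) // ltnW.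
  have : C * k ^+ m * enorm (A^T ^+ m *m xi) <= C * (rho / (4 * C * r1)) * r1.
    apply: ler_pM => //; [|exact: enorm_ge0|].
      by rewrite mulr_ge0 ?exprn_ge0 ?ltW.
    by rewrite ler_wpM2l ?(ltW C0) // (le_trans km).
  have -> : C * (rho / (4 * C * r1)) * r1 = rho / 4.
    by field; rewrite !gt_eqF // (lt_trans r00).
  lra.
(* Nonnegative [j] gives inverse iterates of [A^T], negative [j] forward ones; [j = 0] falls under
   [outer] with exponent 0. *)
case=> m; rewrite /exprz.
  have -> : (invmx (A ^+ m))^T = invmx A^T ^+ m.
    by rewrite trmx_inv trmx_expr -[LHS]/(_^-1) -exprVn.
  case: m => [|m]; last by move=> /andP[h _]; have := inner m; rewrite ltNge h.
  move=> /andP[_]; rewrite expr0 -[1](expr0 A^T) leNgt.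
  by have -> := outer 0.
have -> : (invmx (A ^- m.+1))^T = A^T ^+ m.+1.
  by rewrite -[invmx _]/(_^-1) invrK trmx_expr.
by move=> /andP[_]; rewrite leNgt outer.
Qed.

End expansive_geometry.

(** * Operator norms *)

Section zero_wavelet.
Context {R : realType} {n : nat}.
Local Open Scope complex_scope.
Local Notation V := 'cV[R]_n.+1.

Lemma cintegral0 m : cintegral (fun _ : 'cV[R]_m => 0 : R[i]) = 0.
Proof. by rewrite /cintegral /Rintegral /= integral0. Qed.

Lemma partials0 m (s : seq 'I_m) : partials s (fun _ : 'cV[R]_m => 0 : R) = cst 0.
Proof.
elim: s => //= i s ->; apply/funext => x; exact: derive_cst.
Qed.

Lemma schwartz0 m : schwartz (fun _ : 'cV[R]_m => 0 : R[i]).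
Proof.
have : schwartz_real (fun _ : 'cV[R]_m => 0 : R).
  split=> [s|alpha s]; rewrite partials0.
    by split=> [|i x]; [exact: cst_continuous|exact: derivable_cst].
  by exists 0 => x; rewrite mulr0 normr0.
by split.
Qed.

Lemma expz_gap (b : R) : 1 < b -> forall k : int, b ^ k <= 1 \/ b <= b ^ k.
Proof.
move=> b1 k; have [k0|k0] := leP k 0.
  by left; rewrite -(expr0z b) ler_eXz2l.
by right; rewrite -[leLHS]expr1z ler_eXz2l // -gtz0_ge1.
Qed.

(* [step_norm] takes only the values 0 and [b ^ k], so the anisotropic annulus
   of such an interval is empty: this makes [psi = 0] admissible. *)
Lemma expz_avoids_interval (b : R) : 0 < b -> exists r s : R,
  [/\ 0 < r, r < s & forall k : int, ~ (r <= b ^ k <= s)].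
Proof.
move=> b0; have [b1|b1|->] := ltgtP b 1.
- have ib : 1 < b^-1 by rewrite invf_gt1.
  exists ((2 + b^-1) / 3), ((1 + 2 * b^-1) / 3); split; [lra|lra|].
  move=> k; have := expz_gap _ ib (- k); rewrite -exprz_inv invrK.
  by move=> [h|h] /andP[? ?]; lra.
- exists ((2 + b) / 3), ((1 + 2 * b) / 3); split; [lra|lra|].
  by move=> k; have [h|h] := expz_gap _ b1 k => /andP[? ?]; lra.
- exists 2, 3; split; [lra|lra|] => k; rewrite exp1rz => /andP[? ?]; lra.
Qed.

Lemma zero_in_radial_class (A : 'M[R]_n.+1) (Delta : set V) (r0 r1 : R) :
  A \in unitmx -> radial_class A Delta r0 r1 (fun=> 0).
Proof.
move=> uA.
have fourier0 : fourier (fun _ : V => 0 : R[i]) = cst 0.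
  by apply/funext => xi; rewrite -[RHS](cintegral0 n.+1); congr cintegral;
     apply/funext => x; rewrite mul0r.
have supp0 : tsupport (fourier (fun _ : V => 0 : R[i])) = set0.
  rewrite /tsupport fourier0 (_ : [set x | _] = set0) ?closure0 //.
  by apply/seteqP; split => x //=; rewrite eqxx.
split=> //; last by rewrite supp0.
split; first exact: schwartz0.
  move=> p _ alpha _; rewrite -[RHS](cintegral0 n.+1); congr cintegral.
  by apply/funext => x; rewrite mulr0.
have b0 : 0 < absdet A by rewrite normr_gt0 -unitfE -unitmxE.
have [r [s [r_gt0 rs avoid]]] := expz_avoids_interval _ b0.
exists r, s; split=> //; first by rewrite supp0.
move=> xi; rewrite /anisotropic_annulus /= /step_norm; case: ifP => _.
  by move=> /andP[h _]; have := lt_le_trans r_gt0 h; rewrite ltxx.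
by move=> /avoid.
Qed.

Lemma in_L2_0 m : in_L2 (fun _ : 'cV[R]_m => 0 : R[i]).
Proof. by split; rewrite ?L2norm0 ?ltry. Qed.

Lemma in_L2_opp m (f : 'cV[R]_m -> R[i]) : in_L2 f -> in_L2 (fun x => - f x).
Proof.
move=> [f1 f2 f3]; split; last by rewrite L2norm_opp.
- rewrite (_ : (fun x => _) = \- (fun x => complex.Re (f x))).
    exact: measurable_funN.
  by apply/funext => x /=; case: (f x).
- rewrite (_ : (fun x => _) = \- (fun x => complex.Im (f x))).
    exact: measurable_funN.
  by apply/funext => x /=; case: (f x).
Qed.

Lemma L2_opnorm_zero_wavelet (A : 'M[R]_n.+1) :
  (L2_opnorm (frame_op_sub_id A (fun=> 0%R)) <= 1)%E.
Proof.
(* The operator sends [f] to [- f], so 1 is an admissible constant. *)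
apply: ereal_inf_lbound; exists 1 => //; split=> // f fL2.
exists (fun x => - f x); split; [exact: in_L2_opp| |by rewrite L2norm_opp mul1e].
exists (fun=> 0); last by apply/funext => x; rewrite sub0r.
split; first exact: in_L2_0.
rewrite (_ : (fun F => _) = cst 0%E).
  by apply: cvg_cst; exact: summability.totally_filter.
apply/funext => F /=; rewrite -[RHS](@L2norm0 R n.+1); congr L2norm.
apply/funext => x; rewrite big1 ?subr0 // => jk _.
by rewrite /affine !mulr0.
Qed.

End zero_wavelet.

(** * Lower bound by a function that the frame operator kills *)

Section lower_bound.
Context {R : realType} {n : nat}.
Local Open Scope complex_scope.
Local Notation V := 'cV[R]_n.+1.

Lemma cintegrableZ m (z : R[i]) (h : 'cV[R]_m -> R[i]) :
  cintegrable h -> cintegrable (fun x => z * h x).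
Proof.
move=> [h1 h2].
have Z := @integrable_scale R m.
split.
  have := integrableB measurableT (Z (complex.Re z) _ h1) (Z (complex.Im z) _ h2).
  by congr (integrable _ _ _); apply/funext => x; rewrite /= ReM.
have := integrableD measurableT (Z (complex.Re z) _ h2) (Z (complex.Im z) _ h1).
by congr (integrable _ _ _); apply/funext => x; rewrite /= ImM.
Qed.

Lemma fourier_outside_support (psi : V -> R[i]) (r0 r1 : R) (xi : V) :
  tsupport (fourier psi) `<=` [set xi | r0 <= enorm xi <= r1] ->
  ~ (r0 <= enorm xi <= r1) -> fourier psi xi = 0.
Proof.
move=> supp nxi; apply/eqP/negPn/negP => h; apply: nxi.
by apply: supp; exact: subset_closure.
Qed.

(** By [fourier_affine_eq0] the transform of an affine copy at [xi] in the cube vanishes with that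
    of [psi] at [(invmx (A ^ j))^T *m xi], a point outside the supporting shell. *)
Lemma cinner_band_affine (A : 'M[R]_n.+1) (psi : V -> R[i]) (r0 r1 : R)
    (w : V) (d : R) : A \in unitmx -> schwartz psi ->
  tsupport (fourier psi) `<=` [set xi | r0 <= enorm xi <= r1] ->
  (forall xi, cube w d xi -> forall j : int,
    ~ (r0 <= enorm ((invmx (A ^ j))^T *m xi) <= r1)) ->
  forall j k, cinner (band w d) (affine A psi j k) = 0.
Proof.
move=> uA [s1 s2] supp avoid j k.
have ipsi : cintegrable psi by split; exact: integrable_schwartz.
have uAj : A ^ j \in unitmx by exact: unitrXz.
apply: cinner_band => [|xi xiW].
  have [c cE] := cintegral_affine (A ^ j) (map_mx intr k) uAj.
  by have [] := cE _ (cintegrableZ _ ((absdet A `^ (j%:~R / 2))%:C) psi ipsi).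
apply: fourier_affine_eq0 => //.
exact: fourier_outside_support supp (avoid xi xiW j).
Qed.

(** All partial sums are 0, so the net in [frame_op] is constant equal to [L2norm g], which must be
    its limit 0. An L2 limit determines [g] only up to a null set. *)
Lemma frame_op_band_ae0 (A : 'M[R]_n.+1) (psi f g : V -> R[i]) :
  (forall j k, cinner f (affine A psi j k) = 0) -> frame_op A psi f g ->
  {ae lebesgue_vec R n.+1, forall x, g x = 0}.
Proof.
move=> f0 [[g1 g2 _]]; rewrite (_ : (fun F => _) = cst (L2norm g)); last first.
  apply/funext => F /=; congr L2norm; apply/funext => x.
  by rewrite big1 ?subr0 // => jk _; rewrite f0 mul0r.
move=> gcvg; apply: L2norm_eq0 => //.
have FF : ProperFilter (@summability.totally (int * 'cV[int]_n.+1)%type).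
  exact: summability.totally_filter.
by apply: (cvg_unique _ _ gcvg) => //; exact: cvg_cst.
Qed.

(** Any admissible [C] satisfies |f| <= C |f| in L2 norm, and that norm is finite and positive. If
    no [C] is admissible, the infimum is [+oo] and the bound still holds. *)
Lemma L2_opnorm_ge1 (A : 'M[R]_n.+1) (psi f : V -> R[i]) :
  in_L2 f -> L2norm f != 0%E -> (forall j k, cinner f (affine A psi j k) = 0) ->
  (1 <= L2_opnorm (frame_op_sub_id A psi))%E.
Proof.
move=> fL2 nf f0; apply/ereal_infP => _ [C [C0 HC] <-].
have [h [_ [g gU ->] hle]] := HC f fL2.
have [f1 f2 f3] := fL2; have [[g1 g2 _] _] := gU.
have := frame_op_band_ae0 _ _ _ _ f0 gU.
move=> /(L2norm_sub_ae0 _ _ f1 f2 g1 g2) E; rewrite E in hle.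
have fin : L2norm f \is a fin_num by rewrite ge0_fin_numE // Lnorm_ge0.
move: hle nf; rewrite -(fineK fin) -EFinM !lee_fin => hle nf.
have r0 : 0 < fine (L2norm f).
  by rewrite lt_neqAle eq_sym -eqe nf fine_ge0 // Lnorm_ge0.
by rewrite -(ler_pM2r r0) mul1r.
Qed.

End lower_bound.

Theorem proposition1 (R : realType) (n : nat) (A : 'M[R]_n.+1)
    (Delta : set 'cV[R]_n.+1) (lambda : R) (v : 'cV[R]_n.+1) (r0 r1 : R) :
  expansive A ->
  expansive_ellipsoid A Delta ->
  v != 0 ->
  A^T *m v = lambda *: v ->
  0 < r0 -> r0 < r1 ->
  r1 / r0 < `|lambda| ->
  epsilon2 A Delta r0 r1 = 1%E.
Proof.
move=> eA eD v0 Av r00 r01 rl; have uA := expansive_unitmx A eA.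
apply/eqP; rewrite eq_le; apply/andP; split.
  apply: le_trans (L2_opnorm_zero_wavelet A); apply: ereal_inf_lbound.
  by exists (fun=> 0) => //; exact: zero_in_radial_class.
(* The cube is fixed before [psi]: one test function serves the whole class. *)
have [w [d [d0 avoid]]] := avoiding_cube A Delta lambda v r0 r1 uA eD v0 Av r00 r01 rl.
apply/ereal_infP => _ [psi [_ [spsi _ _] supp] <-].
apply: (L2_opnorm_ge1 A psi (band w d)).
- exact: in_L2_band.
- exact: L2norm_band_neq0.
- exact: cinner_band_affine spsi supp avoid.
Qed.
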